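(* Under the succinct encoding, STOCHASTIC-ANCHOR-SUFFICIENCY-CHECK (given a stochastic decision problem $\mathcal{D}_S=(A,X_1,\ldots,X_n,U,P)$ and $I\subseteq\{1,\ldots,n\}$, decide whether $I$ is stochastically anchor-sufficient) is PP-hard.
   Context: A stochastic decision problem is a tuple $(A,X_1,\ldots,X_n,U,P)$ with $A$ a finite set of actions, $X_i$ finite sets, $S=X_1\times\cdots\times X_n$, $U:A\times S\to\mathbb{Q}$, $P$ a probability distribution on $S$. For $S\sim P$, $\mathrm{supp}(S_I)$ is the set of values $\alpha$ of the $I$-coordinates with $P(S_I=\alpha)>0$, and $\mathrm{Opt}^{\mathrm{stoch}}_I(\alpha)=\arg\max_{a\in A}\mathbb{E}[U(a,S)\mid S_I=\alpha]$. $I$ is stochastically anchor-sufficient if there exist $\alpha\in\mathrm{supp}(S_I)$ and $a\in A$ with $\mathrm{Opt}^{\mathrm{stoch}}_I(\alpha)=\{a\}$. Succinct encoding: the state space is not listed; coordinate domains are given, $U(a,s)$ is computed by a polynomial-size circuit, and $P$ is given by a polynomial-size description (e.g. the uniform distribution on $\{0,1\}^n$). *)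

(* Defs.v *)
From mathcomp Require Import all_boot all_order all_algebra.

Set Implicit Arguments.
Unset Strict Implicit.
Unset Printing Implicit Defensive.

Import Order.TTheory GRing.Theory Num.Theory.

Record stoch_problem := StochProblem {
  sp_action : finType;
  sp_n : nat;
  sp_coord : 'I_sp_n -> finType;
  sp_U : sp_action -> {dffun forall i, sp_coord i} -> rat;
  sp_P : {dffun forall i, sp_coord i} -> rat;
  sp_P_ge0 : forall s, (0 <= sp_P s)%R;
  sp_P_sum1 : (\sum_s sp_P s = 1)%R
}.

Section StochProblem.

Local Open Scope ring_scope.

Variables (D : stoch_problem) (I : {set 'I_(sp_n D)}).

Definition sp_state := {dffun forall i, @sp_coord D i}.

Definition sub_state :=
  {dffun forall i : {i : 'I_(sp_n D) | i \in I}, sp_coord (val i)}.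

Definition proj_state (s : sp_state) : sub_state := [ffun i => s (val i)].

Definition prob_proj (alpha : sub_state) : rat :=
  \sum_(s : sp_state | proj_state s == alpha) sp_P s.

Definition supp_proj (alpha : sub_state) : bool := 0 < prob_proj alpha.

Definition cond_expect (a : sp_action D) (alpha : sub_state) : rat :=
  (\sum_(s : sp_state | proj_state s == alpha) sp_P s * sp_U a s)
    / prob_proj alpha.

Definition opt_stoch (alpha : sub_state) : {set sp_action D} :=
  [set a | [forall b, cond_expect b alpha <= cond_expect a alpha]].

Definition stoch_anchor_sufficient : Prop :=
  exists alpha : sub_state,
    supp_proj alpha /\ exists a : sp_action D, opt_stoch alpha = [set a].

End StochProblem.

(* Straight-line circuits.  Wires are named by their distance to the wire
   created last: in a gate, 0 is the output of the preceding gate, and the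
   inputs come after all the gates, in order.  Missing wires carry false. *)
Inductive gate :=
  | GConst of bool
  | GNot of nat
  | GAnd of nat & nat
  | GOr of nat & nat.

Definition wire (w : seq bool) (i : nat) : bool := nth false w i.

Definition gate_val (w : seq bool) (g : gate) : bool :=
  match g with
  | GConst b => b
  | GNot i => ~~ wire w i
  | GAnd i j => wire w i && wire w j
  | GOr i j => wire w i || wire w j
  end.

Definition wires (gs : seq gate) (input : seq bool) : seq bool :=
  foldl (fun w g => gate_val w g :: w) input gs.

(* A circuit computing a rational number, given by its sign and by the binary
   expansions (least significant bit first) of a numerator and a denominator. *)
Record rat_circuit := RatCircuit {
  rc_gates : seq gate;
  rc_sign : nat;
  rc_num : seq nat;
  rc_den : seq nat
}.

Definition nat_of_bits (bs : seq bool) : nat :=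
  foldr (fun (b : bool) m => b + m.*2) 0 bs.

(* A zero denominator yields the value 0. *)
Definition rat_circuit_val (c : rat_circuit) (input : seq bool) : rat :=
  let w := wires (rc_gates c) input in
  let read ks := (nat_of_bits (map (wire w) ks))%:R%R : rat in
  ((-1) ^+ wire w (rc_sign c) * (read (rc_num c) / read (rc_den c)))%R.

(* The binary expansion of k < d, least significant bit first. *)
Definition bits_of_nat (d k : nat) : seq bool :=
  mkseq (fun j => odd (k %/ 2 ^ j)) (up_log 2 d).

(* Up to renaming, the actions are 0, ..., m - 1 and the i-th coordinate ranges
   over 0, ..., d_i - 1, where doms = [:: d_0; ...; d_(n-1)]. *)
Definition dom_coord (doms : seq nat) (i : 'I_(size doms)) : finType :=
  'I_(nth 0 doms i).

Definition dom_state (doms : seq nat) := {dffun forall i, @dom_coord doms i}.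

Definition bits_of_state (doms : seq nat) (s : dom_state doms) : seq bool :=
  flatten [seq bits_of_nat (nth 0 doms i) (s i : 'I_(nth 0 doms i))
             | i : 'I_(size doms) <- enum 'I_(size doms)].

Definition circuit_U (m : nat) (doms : seq nat) (c : rat_circuit)
    (a : 'I_m) (s : dom_state doms) : rat :=
  rat_circuit_val c (bits_of_nat m a ++ bits_of_state s).

Definition circuit_P (doms : seq nat) (c : rat_circuit)
    (s : dom_state doms) : rat :=
  rat_circuit_val c (bits_of_state s).

(* P is described by a circuit for its probability mass function; the uniform
   distribution on {0,1}^n, e.g., is described by constant gates with the
   outputs 1 and 2^n. *)
Record succinct_instance := SuccinctInstance {
  si_actions : nat;
  si_doms : seq nat;
  si_U : rat_circuit;
  si_P : rat_circuit;
  si_P_ge0 : forall s : dom_state si_doms, (0 <= circuit_P si_P s)%R;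
  si_P_sum1 : (\sum_(s : dom_state si_doms) circuit_P si_P s = 1)%R;
  si_I : {set 'I_(size si_doms)}
}.

Definition problem_of_instance (x : succinct_instance) : stoch_problem :=
  @StochProblem 'I_(si_actions x) (size (si_doms x)) (@dom_coord (si_doms x))
    (circuit_U (si_U x)) (circuit_P (si_P x)) (@si_P_ge0 x) (si_P_sum1 x).

(* Self-delimiting binary encodings.  The number of actions, the sizes of the
   domains and the names of the wires are in unary. *)
Definition enc_nat (n : nat) : seq bool := rcons (nseq n true) false.

Definition enc_bool (b : bool) : seq bool := [:: b].

Definition enc_seq (T : Type) (e : T -> seq bool) (s : seq T) : seq bool :=
  foldr (fun x r => true :: e x ++ r) [:: false] s.

Definition enc_gate (g : gate) : seq bool :=
  match g with
  | GConst b => [:: false; false; b]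
  | GNot i => [:: false; true] ++ enc_nat i
  | GAnd i j => [:: true; false] ++ enc_nat i ++ enc_nat j
  | GOr i j => [:: true; true] ++ enc_nat i ++ enc_nat j
  end.

Definition enc_rat_circuit (c : rat_circuit) : seq bool :=
  enc_seq enc_gate (rc_gates c) ++ enc_nat (rc_sign c)
    ++ enc_seq enc_nat (rc_num c) ++ enc_seq enc_nat (rc_den c).

Definition enc_instance (x : succinct_instance) : seq bool :=
  enc_nat (si_actions x) ++ enc_seq enc_nat (si_doms x)
    ++ enc_rat_circuit (si_U x) ++ enc_rat_circuit (si_P x)
    ++ enc_seq enc_bool [seq i \in si_I x | i : 'I_(size (si_doms x)) <- enum 'I_(size (si_doms x))].

Definition prefix_code (T : Type) (e : T -> seq bool) : Prop :=
  forall x y s t, e x ++ s = e y ++ t -> x = y /\ s = t.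

Lemma enc_nat_prefix : prefix_code enc_nat.
Proof.
rewrite /enc_nat; elim=> [|n IHn] [|m] s t //=; first by case.
by case=> /IHn [-> ->].
Qed.

Lemma enc_bool_prefix : prefix_code enc_bool.
Proof. by move=> x y s t [-> ->]. Qed.

Lemma enc_seq_prefix (T : Type) (e : T -> seq bool) :
  prefix_code e -> prefix_code (enc_seq e).
Proof.
move=> he; elim=> [|x xs IHx] [|y ys] s t //=; first by case.
by case; rewrite -!catA => /he [-> /IHx [-> ->]].
Qed.

Lemma enc_gate_prefix : prefix_code enc_gate.
Proof.
case=> [b|i|i j|i j] [b'|i'|i' j'|i' j'] s t //=.
- by case=> -> ->.
- by case=> /enc_nat_prefix [-> ->].
- by case; rewrite -!catA => /enc_nat_prefix [-> /enc_nat_prefix [-> ->]].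
- by case; rewrite -!catA => /enc_nat_prefix [-> /enc_nat_prefix [-> ->]].
Qed.

Lemma enc_rat_circuit_prefix : prefix_code enc_rat_circuit.
Proof.
case=> [g s n d] [g' s' n' d'] u v; rewrite /enc_rat_circuit /= -!catA.
move=> /(enc_seq_prefix enc_gate_prefix) [-> /enc_nat_prefix [->]].
move=> /(enc_seq_prefix enc_nat_prefix) [->].
by move=> /(enc_seq_prefix enc_nat_prefix) [-> ->].
Qed.

Lemma enc_instance_inj (x y : succinct_instance) :
  enc_instance x = enc_instance y ->
  [/\ si_actions x = si_actions y, si_U x = si_U y, si_P x = si_P y &
      existT (fun doms => {set 'I_(size doms)}) (si_doms x) (si_I x)
      = existT (fun doms => {set 'I_(size doms)}) (si_doms y) (si_I y)].
Proof.
case: x y => [m d u p ge0 sum1 I] [m' d' u' p' ge0' sum1' I'].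
rewrite /enc_instance /= => {ge0 sum1 ge0' sum1'}.
move=> /enc_nat_prefix [-> /(enc_seq_prefix enc_nat_prefix) [dd']].
case: d' / dd' I' => I' /enc_rat_circuit_prefix [->].
move=> /enc_rat_circuit_prefix [->]; rewrite -[LHS]cats0 -[RHS]cats0.
move=> /(enc_seq_prefix enc_bool_prefix) [/eq_in_map eqI _]; split=> //.
by congr existT; apply/setP => i; apply: eqI; rewrite mem_enum.
Qed.

(* Deterministic multitape Turing machines, with tm_tapes + 1 two-way infinite
   tapes.  The tape alphabet contains the blank None, the two bits and
   finitely many further symbols. *)
Inductive move := MoveLeft | MoveStay | MoveRight.

Definition cell (T : finType) : finType := option (bool + T).

Record turing_machine := TuringMachine {
  tm_tapes : nat;
  tm_sym : finType;
  tm_state : finType;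
  tm_start : tm_state;
  tm_halt : pred tm_state;
  tm_trans : tm_state -> {ffun 'I_tm_tapes.+1 -> cell tm_sym} ->
             tm_state * ('I_tm_tapes.+1 -> cell tm_sym * move)
}.

(* The cells to the left of the head, nearest first, and the cells from the
   head on; all the other cells are blank. *)
Definition tape (T : finType) := (seq (cell T) * seq (cell T))%type.

Definition tape_read (T : finType) (t : tape T) : cell T := head None t.2.

Definition tape_write (T : finType) (c : cell T) (t : tape T) : tape T :=
  (t.1, c :: behead t.2).

Definition tape_move (T : finType) (m : move) (t : tape T) : tape T :=
  match m with
  | MoveLeft => (behead t.1, head None t.1 :: t.2)
  | MoveStay => t
  | MoveRight => (tape_read t :: t.1, behead t.2)
  end.

Definition tape_of_bits (T : finType) (bs : seq bool) : tape T :=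
  ([::], [seq Some (inl b) | b <- bs]).

(* The bits from the head on, up to the first cell that does not hold a bit. *)
Definition bits_of_tape (T : finType) (t : tape T) : seq bool :=
  let fix go (cs : seq (cell T)) :=
    if cs is Some (inl b) :: cs' then b :: go cs' else [::] in
  go t.2.

Section TuringMachine.

Variable M : turing_machine.

Definition tm_config : Type :=
  tm_state M * {ffun 'I_(tm_tapes M).+1 -> tape (tm_sym M)}.

(* The i-th input is written on the i-th tape. *)
Definition tm_init (inputs : seq (seq bool)) : tm_config :=
  (tm_start M, [ffun i : 'I__ => tape_of_bits _ (nth [::] inputs i)]).

Definition tm_step (c : tm_config) : tm_config :=
  if tm_halt c.1 then c else
  let: (q, act) := tm_trans c.1 [ffun i => tape_read (c.2 i)] in
  (q, [ffun i => tape_move (act i).2 (tape_write (act i).1 (c.2 i))]).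

(* The content of the first tape, if M halts after at most t steps. *)
Definition tm_run (inputs : seq (seq bool)) (t : nat) : option (seq bool) :=
  let c := iter t tm_step (tm_init inputs) in
  if tm_halt c.1 then Some (bits_of_tape (c.2 ord0)) else None.

End TuringMachine.

Definition poly_time (f : seq bool -> seq bool) : Prop :=
  exists (M : turing_machine) (q : {poly nat}),
    forall x, tm_run M [:: x] q.[size x]%R = Some (f x).

Definition language := seq bool -> Prop.

(* L is decided in polynomial time by a probabilistic machine whose coin
   tosses are p(|x|) uniform random bits provided on the second tape: x is in L
   iff the probability of acceptance is greater than 1/2. *)
Definition in_PP (L : language) : Prop :=
  exists (M : turing_machine) (p q : {poly nat}),
    (forall x (r : (p.[size x]%R).-tuple bool),
        isSome (tm_run M [:: x; val r] q.[size x]%R)) /\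
    (forall x, L x <->
        2 ^ p.[size x]%R <
        2 * #|[set r : (p.[size x]%R).-tuple bool |
                 tm_run M [:: x; val r] q.[size x]%R == Some [:: true]]|).

Record decision_problem := DecisionProblem {
  dp_instance : Type;
  dp_encode : dp_instance -> seq bool;
  dp_yes : dp_instance -> Prop
}.

(* Karp reductions; every word is sent to (the encoding of) an instance. *)
Definition poly_reducible (L : language) (Q : decision_problem) : Prop :=
  exists f : seq bool -> dp_instance Q,
    poly_time (fun x => dp_encode (f x)) /\ forall x, L x <-> dp_yes (f x).

Definition PP_hard (Q : decision_problem) : Prop :=
  forall L, in_PP L -> poly_reducible L Q.

Definition stochastic_anchor_sufficiency_check : decision_problem :=
  @DecisionProblem succinct_instance enc_instance
    (fun x => @stoch_anchor_sufficient (problem_of_instance x) (si_I x)).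

(* Main.v *)
From HB Require Import structures.
From mathcomp Require Import all_boot all_order all_algebra.
From mathcomp Require Import zify.
Require Import Defs.

Set Implicit Arguments.
Unset Strict Implicit.
Unset Printing Implicit Defensive.

(* Let M decide L with p(|x|) coins in time q(|x|).  The instance for x has
   three actions: action 0 has the utility 2 if M accepts and 0 otherwise, the
   two others have the utility 1.  With I empty and uniform coins, the optimal
   action is unique iff action 0 is strictly better than the two tied ones, i.e.,
   iff the acceptance probability exceeds 1/2.

   The circuit simulates M row by row.  Tapes are centred at the heads and
   folded there, so that the row at time t+1 is computed from left to right: its
   first cell sees the state and the symbols read, and the chosen transition is
   handed on from cell to cell.  As wires are named by distance, all the cells
   at the same place of the loops have literally the same gates; to make this
   true also of the cells that fetch a coin, the state space has spare bits and
   the coins are as far apart in the input as the blocks of gates are in the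
   circuit.  Hence the encoded instance is produced by nested loops over the
   bits of x with constant bodies, which a Turing machine runs with one copy of x
   per nesting level. *)

(** * Turing machines running loop programs *)

(** A tape is stored as two lists, so trailing blanks give several representations of the same tape;
    this is equality up to them. *)
Definition tape_equiv (T : finType) (t u : tape T) : Prop :=
  (forall i, nth None t.1 i = nth None u.1 i) /\
  (forall i, nth None t.2 i = nth None u.2 i).

Lemma tape_equiv_trans (T : finType) (t u v : tape T) :
  tape_equiv t u -> tape_equiv u v -> tape_equiv t v.
Proof. by case=> h1 h2 [h3 h4]; split=> i; rewrite ?h1 ?h2. Qed.

Lemma tape_read_nth (T : finType) (t : tape T) : tape_read t = nth None t.2 0.
Proof. by case: t => l []. Qed.

Lemma tape_equiv_read (T : finType) (t u : tape T) :
  tape_equiv t u -> tape_read t = tape_read u.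
Proof. by case=> _ h; rewrite !tape_read_nth. Qed.

Lemma nth_tape_write_move (T : finType) (m : move) c (t : tape T) j :
  let t' := tape_move m (tape_write c t) in
  (nth None t'.1 j = match m, j with
    | MoveLeft, _ => nth None t.1 j.+1
    | MoveStay, _ => nth None t.1 j
    | MoveRight, 0 => c
    | MoveRight, j'.+1 => nth None t.1 j'
    end) * 
  (nth None t'.2 j = match m, j with
    | MoveLeft, 0 => nth None t.1 0
    | MoveLeft, 1 => c
    | MoveLeft, j'.+1 => nth None t.2 j'
    | MoveStay, 0 => c
    | MoveStay, _ => nth None t.2 j
    | MoveRight, _ => nth None t.2 j.+1
    end).
Proof.
case: t => l r; case: m; rewrite /tape_write /=.
- by split; [rewrite nth_behead | case: j => [|[|j]] //=; rewrite ?nth_behead ?nth0].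
- by split=> //; case: j => [|j] //=; rewrite nth_behead.
- by split; [case: j | rewrite !nth_behead].
Qed.

Lemma nth_tape_move (T : finType) (m : move) (t : tape T) j :
  let t' := tape_move m t in
  (nth None t'.1 j = match m, j with
    | MoveLeft, _ => nth None t.1 j.+1
    | MoveStay, _ => nth None t.1 j
    | MoveRight, 0 => nth None t.2 0
    | MoveRight, j'.+1 => nth None t.1 j'
    end) * 
  (nth None t'.2 j = match m, j with
    | MoveLeft, 0 => nth None t.1 0
    | MoveLeft, j'.+1 => nth None t.2 j'
    | MoveStay, _ => nth None t.2 j
    | MoveRight, _ => nth None t.2 j.+1
    end).
Proof.
case: t => l r; case: m => /=.
- by split; [rewrite nth_behead | case: j => [|j] //=; rewrite nth0].
- by [].
- by split; [case: j => [|j] //=; rewrite tape_read_nth | rewrite nth_behead].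
Qed.

Lemma tape_equiv_write_move (T : finType) m c (t u : tape T) :
  tape_equiv t u ->
  tape_equiv (tape_move m (tape_write c t)) (tape_move m (tape_write c u)).
Proof.
move=> [h1 h2]; split=> j; rewrite !nth_tape_write_move.
  by case: m => //; case: j.
by case: m => //; case: j => // -[|j].
Qed.

Lemma tape_equiv_move (T : finType) m (t u : tape T) :
  tape_equiv t u ->
  tape_equiv (tape_move m (tape_write (tape_read t) t)) (tape_move m u).
Proof.
move=> [h1 h2]; split=> j; rewrite !(nth_tape_write_move, nth_tape_move).
  by case: m => //; case: j => //=; rewrite tape_read_nth.
by case: m => //; case: j => [|[|j]] //; rewrite tape_read_nth.
Qed.

(** * Loop programs and their compilation to a multitape machine *)

Inductive prog :=
  | PEmit of seq bool
  | PCat of prog & prog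
  | PLoop of prog & prog.

Fixpoint den (p : prog) (x : seq bool) : seq bool :=
  match p with
  | PEmit s => s
  | PCat p1 p2 => den p1 x ++ den p2 x
  | PLoop p0 p1 => flatten [seq if b then den p1 x else den p0 x | b <- x]
  end.

Fixpoint depth (p : prog) : nat :=
  match p with
  | PEmit _ => 0
  | PCat p1 p2 => maxn (depth p1) (depth p2)
  | PLoop p1 p2 => (maxn (depth p1) (depth p2)).+1
  end.

Inductive instr :=
  | IInit
  | IEmit of bool
  | IMove of nat & move
  | IBranch of nat & nat & nat & nat.

(* The output is produced backwards, the head of tape 0 moving to the left, so
   loops run through the input from right to left.  A loop at nesting level k
   uses its own copy of the input on tape k, whose head rests after the last
   bit when the loop is not active. *)
Fixpoint comp (p : prog) (k o : nat) : seq instr :=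
  match p with
  | PEmit s => rev [seq IEmit b | b <- s]
  | PCat p1 p2 =>
      let c2 := comp p2 k o in c2 ++ comp p1 k (o + size c2)
  | PLoop p0 p1 =>
      let c0 := comp p0 k.+1 (o + 2) in
      let o1 := o + 2 + size c0 + 1 in
      let c1 := comp p1 k.+1 o1 in
      let e := o1 + size c1 + 1 in
      [:: IMove k MoveLeft; IBranch k e (o + 2) o1] ++ c0 ++ [:: IBranch k o o o]
        ++ c1 ++ [:: IBranch k o o o; IMove k MoveRight; IBranch k (e + 2) e e]
  end.

(** Both bodies are counted, as a bound for whichever is run; the 3 covers the head move, the branch
    and the jump back. In [run_time], the [+ 2] leaves the loop and the last summand rewinds the
    head at two steps per bit. *)
Definition loop_iter_time p0 p1 := p0 + p1 + 3.
Fixpoint run_time (p : prog) (n : nat) : nat :=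
  match p with
  | PEmit s => size s
  | PCat p1 p2 => run_time p2 n + run_time p1 n
  | PLoop p0 p1 => n * loop_iter_time (run_time p0 n) (run_time p1 n) + 2
                   + (1 + (2 * n + 1))
  end.

Section Machine.

Variables (D : nat) (code : seq instr).

Let N := size code.
Let cellv := cell void.
Let tapev := tape void.

(** The control state is the program counter. [IInit] repeats itself while it moves the word on tape
    0 to all the other tapes and erases tape 0, which then serves for the output. *)
Definition code_trans (pc : 'I_N.+1) (reads : {ffun 'I_D.+1 -> cellv}) :
    'I_N.+1 * ('I_D.+1 -> cellv * move) :=
  match nth IInit code pc with
  | IInit =>
      if isSome (reads ord0) then
        (pc, fun i => (if i == ord0 then None else reads ord0, MoveRight))
      else (inord pc.+1, fun i => (reads i, MoveStay))
  | IEmit b =>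
      (inord pc.+1, fun i => if i == ord0 then (Some (inl b), MoveLeft)
                             else (reads i, MoveStay))
  | IMove k m =>
      (inord pc.+1, fun i => (reads i, if i == k :> nat then m else MoveStay))
  | IBranch k eN e0 e1 =>
      (inord (if reads (inord k) is Some (inl b) then if b then e1 else e0 else eN),
       fun i => (reads i, MoveStay))
  end.

Definition code_machine : turing_machine :=
  @TuringMachine D void 'I_N.+1 ord0 (pred1 ord_max) code_trans.

Let M := code_machine.

Definition cfg (c : tm_config M) (pc : nat) (tf : nat -> tapev) : Prop :=
  (c.1 : 'I_N.+1) = pc :> nat /\ forall i : 'I_D.+1, tape_equiv (c.2 i) (tf i).

Lemma cfg_equiv c pc tf tg :
  cfg c pc tf -> (forall i, i <= D -> tape_equiv (tf i) (tg i)) -> cfg c pc tg.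
Proof.
move=> [h1 h2] h; split=> // i; apply: tape_equiv_trans (h2 i) (h i _).
by rewrite -ltnS.
Qed.

Lemma tm_stepE (c : tm_config M) pc tf : pc < N -> cfg c pc tf ->
  tm_step c = let: (q, act) := code_trans c.1 [ffun i => tape_read (c.2 i)] in
  (q, [ffun i => tape_move (act i).2 (tape_write (act i).1 (c.2 i))]).
Proof.
move=> ltN [hpc _]; rewrite /tm_step /=; case: eqP => // E.
by move: hpc ltN; rewrite E /= => <-; rewrite ltnn.
Qed.

Lemma step_emit c pc tf b : pc < N -> nth IInit code pc = IEmit b ->
  cfg c pc tf ->
  cfg (tm_step c) pc.+1
    (fun i => if i == 0 then tape_move MoveLeft (tape_write (Some (inl b)) (tf i))
              else tf i).
Proof.
move=> ltN hc hcfg; rewrite (tm_stepE ltN hcfg).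
case: hcfg => hpc ht; rewrite /code_trans hpc hc; split=> [|i] /=.
  by rewrite inordK.
rewrite ffunE -val_eqE /=; case: eqP => // _.
  exact: (tape_equiv_write_move MoveLeft (Some (inl b))).
by rewrite ffunE; apply: (@tape_equiv_move _ MoveStay).
Qed.

Lemma step_move c pc tf k m : pc < N -> nth IInit code pc = IMove k m ->
  cfg c pc tf ->
  cfg (tm_step c) pc.+1 (fun i => if i == k then tape_move m (tf i) else tf i).
Proof.
move=> ltN hc hcfg; rewrite (tm_stepE ltN hcfg).
case: hcfg => hpc ht; rewrite /code_trans hpc hc; split=> [|i] /=.
  by rewrite inordK.
rewrite !ffunE /=; case: eqP => _; first exact: tape_equiv_move.
exact: (@tape_equiv_move _ MoveStay).
Qed.

Lemma step_branch c pc tf k eN e0 e1 : pc < N ->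
  nth IInit code pc = IBranch k eN e0 e1 -> k <= D -> eN <= N -> e0 <= N -> e1 <= N ->
  cfg c pc tf ->
  cfg (tm_step c)
    (if tape_read (tf k) is Some (inl b) then if b then e1 else e0 else eN) tf.
Proof.
move=> ltN hc hk hN h0 h1 hcfg; rewrite (tm_stepE ltN hcfg).
case: hcfg => hpc ht; rewrite /code_trans hpc hc; split=> [|i] /=.
  rewrite inordK ffunE (tape_equiv_read (ht _)) inordK ?ltnS //.
  by case: (tape_read _) => [[[]|[]]|].
by rewrite !ffunE /=; apply: (@tape_equiv_move _ MoveStay).
Qed.

Lemma step_init c pc tf : pc < N -> nth IInit code pc = IInit -> cfg c pc tf ->
  if isSome (tape_read (tf 0)) then
    cfg (tm_step c) pc (fun i => tape_move MoveRight
      (tape_write (if i == 0 then None else tape_read (tf 0)) (tf i)))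
  else cfg (tm_step c) pc.+1 tf.
Proof.
move=> ltN hc hcfg; rewrite (tm_stepE ltN hcfg).
case: hcfg => hpc ht; rewrite /code_trans hpc hc ffunE (tape_equiv_read (ht _)) /=.
case: (isSome (tape_read (tf 0))); split=> [|i] //=.
- rewrite ffunE -val_eqE /=.
  exact: (tape_equiv_write_move MoveRight (if val i == 0 then _ else _)).
- by rewrite inordK.
- by rewrite !ffunE /=; apply: (@tape_equiv_move _ MoveStay).
Qed.

(** A bound on the number of steps is enough, because the halting configuration is stationary
    ([cfg_halt]). *)
Definition reach (c : tm_config M) (n pc : nat) (tf : nat -> tapev) : Prop :=
  exists2 t, t <= n & cfg (iter t (@tm_step M) c) pc tf.

Lemma reach0 c n pc tf : cfg c pc tf -> reach c n pc tf.
Proof. by exists 0. Qed.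

Lemma reach_trans c n1 n2 pc pc' tf tf' :
  reach c n1 pc tf -> (forall c', cfg c' pc tf -> reach c' n2 pc' tf') ->
  reach c (n1 + n2) pc' tf'.
Proof.
move=> [t1 l1 h1] /(_ _ h1) [t2 l2 h2]; exists (t2 + t1); first by lia.
by rewrite iterD.
Qed.

Lemma reach_step c n pc pc' tf tf' :
  cfg (tm_step c) pc tf -> (forall c', cfg c' pc tf -> reach c' n pc' tf') ->
  reach c n.+1 pc' tf'.
Proof.
move=> h1 /(_ _ h1) [t2 l2 h2]; exists t2.+1; first by lia.
by rewrite iterSr.
Qed.

Lemma reach_le c n m pc tf : n <= m -> reach c n pc tf -> reach c m pc tf.
Proof. by move=> h [t lt ht]; exists t => //; apply: leq_trans h. Qed.

Definition code_at (o : nat) (s : seq instr) : Prop :=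
  o + size s <= N /\ forall i, i < size s -> nth IInit code (o + i) = nth IInit s i.

Lemma code_at_cat o s1 s2 :
  code_at o (s1 ++ s2) -> code_at o s1 /\ code_at (o + size s1) s2.
Proof.
rewrite /code_at size_cat => -[h1 h2]; split; split=> [|i hi]; try lia.
  by rewrite h2 ?nth_cat ?hi //; lia.
rewrite -addnA h2 ?nth_cat; last by lia.
by rewrite ltnNge leq_addr addKn.
Qed.

Lemma code_at_cons o a s :
  code_at o (a :: s) -> [/\ o < N, nth IInit code o = a & code_at o.+1 s].
Proof.
rewrite /code_at /= => -[h1 h2]; split; first by lia.
  by have := h2 0 isT; rewrite addn0.
by split=> [|i hi]; [lia | rewrite addSnnS (h2 i.+1)].
Qed.

Let cells (s : seq bool) : seq cellv := [seq Some (inl b) | b <- s].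

(** The head of tape 0 rests on the blank just before the output written so far, where the next bit
    goes. *)
Definition tapes (out : seq bool) (tp : nat -> tapev) : nat -> tapev :=
  fun i => if i == 0 then ([::], None :: cells out) else tp i.

Definition upd (tp : nat -> tapev) k t : nat -> tapev :=
  fun i => if i == k then t else tp i.

Section Run.

Variable x : seq bool.
Let X := cells x.

Lemma tapes_upd_move out tp k t m i : 0 < k ->
  tape_equiv (if i == k then tape_move m (tapes out (upd tp k t) i)
              else tapes out (upd tp k t) i)
             (tapes out (upd tp k (tape_move m t)) i).
Proof.
rewrite /tapes /upd; have [->|_] := eqVneq i k; last by [].
by case: k.
Qed.

(** The two instructions at [e] alternate between moving right and testing for a blank; induction on
    the bits [x2] not yet passed. *)
Lemma rewind_ok k e out tp x2 x1 c :
  0 < k -> k <= D -> e + 2 <= N ->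
  nth IInit code e = IMove k MoveRight -> nth IInit code e.+1 = IBranch k (e + 2) e e ->
  x = x1 ++ x2 ->
  cfg c e.+1 (tapes out (upd tp k (rev (cells x1), cells x2))) ->
  reach c (2 * size x2 + 1) (e + 2) (tapes out (upd tp k (rev X, [::]))).
Proof.
move=> k0 kD eN c1 c2; elim: x2 x1 c => [|b x2 IH] x1 c hx hc.
  have := step_branch _ c2 kD _ _ _ hc.
  rewrite {1}/tapes {1}/upd (gtn_eqF k0) eqxx /= => h.
  apply: (@reach_step _ 0) => [|c' h']; first by apply: h; lia.
  by apply: reach0; rewrite /X hx cats0.
have := step_branch _ c2 kD _ _ _ hc.
rewrite {1}/tapes {1}/upd (gtn_eqF k0) eqxx /=.
have -> : (if b then e else e) = e by case: b {hx hc}.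
move=> h; rewrite mulnS -addnA.
apply: reach_step => [|c' h']; first by apply: h; lia.
apply: reach_step => [|c'' h'']; first by apply: step_move h'; [lia|exact: c1].
apply: (IH (rcons x1 b)); first by rewrite hx cat_rcons.
apply: cfg_equiv h'' _ => i _; apply: tape_equiv_trans (tapes_upd_move _ _ _ _ _ k0) _.
by rewrite /tape_move /= /cells map_rcons rev_rcons.
Qed.

(** The invariant of compiled fragments: the tapes from [k] on are found and left in the resting
    position, and the new output is put in front of [out]. A body may thus be run any number of
    times with the tapes of deeper levels. *)
Definition comp_spec p := forall k o c tp out, 0 < k -> k + depth p <= D.+1 ->
  code_at o (comp p k o) -> (forall j, k <= j -> j <= D -> tp j = (rev X, [::])) ->
  cfg c o (tapes out tp) ->
  reach c (run_time p (size x)) (o + size (comp p k o)) (tapes (den p x ++ out) tp).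

Lemma comp_ok p : comp_spec p.
Proof.
elim: p => [s|p1 IH1 p2 IH2|p0 IH0 p1 IH1] k o c tp out k0 hD hc htp hcfg.
- rewrite /= size_rev size_map; move: hc {hD}; rewrite /=.
  elim/last_ind: s o c out hcfg => [|s b IH] o c out hcfg.
    by move=> _; rewrite addn0; apply: reach0.
  rewrite map_rcons rev_rcons => /code_at_cons[lo ho hs]; rewrite size_rcons.
  apply: reach_step => [|c' h']; first exact: step_emit ho hcfg.
  rewrite -addSnnS -cats1 -catA; apply: IH _ hs.
  apply: cfg_equiv h' _ => i _; rewrite /tapes; case: eqP => //.
- move: hc => /=; case/code_at_cat => hc2 hc1; rewrite size_cat addnA.
  move: hD => /= hD.
  apply: reach_trans => [|c' h']; first by apply: (IH2 k) hcfg => //; lia.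
  by rewrite -catA; apply: (IH1 k) h' => //; lia.
- set co := comp _ _ _ in hc *; move: hc.
  rewrite /co /=.
  set c0 := comp p0 _ _; set o1 := o + 2 + size c0 + 1; set c1 := comp p1 _ _.
  set e := o1 + size c1 + 1.
  case/code_at_cons=> lo ho /code_at_cons[lo' ho' /code_at_cat[hc0]].
  case/code_at_cons=> lo'' ho'' /code_at_cat[hc1 /code_at_cons[lj hj]].
  case/code_at_cons=> le he /code_at_cons[le' he' _].
  have kD : k <= D by move: hD => /=; lia.
  have -> : o + (size (c0 ++ IBranch k o o o :: c1 ++
     [:: IBranch k o o o; IMove k MoveRight; IBranch k (e + 2) e e])).+2 = e + 2.
    by rewrite !(size_cat, size_map) /= size_cat /= /e /o1; lia.
  have eE : (o.+2 + size c0).+1 + size c1 = e.-1 by rewrite /e /o1; lia.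
  have o1E : (o.+2 + size c0).+1 = o1 by rewrite /o1; lia.
  have e0 : 0 < e by rewrite /e; lia.
  rewrite eE prednK // in lj hj le he le' he'.
  rewrite o1E in hc1; rewrite -addn2 in hc0.
  have hD0 : k.+1 + depth p0 <= D.+1 by move: hD => /=; lia.
  have hD1 : k.+1 + depth p1 <= D.+1 by move: hD => /=; lia.
  have eN : e + 2 <= N by lia.
  have o1N : o1 <= N by lia.
  (* The iterations of the loop: [x2] has been treated and [x1], to the left of the head, remains.
     The loop reads the last bit first, hence the induction on [x1] from its end. *)
  have main : forall x1 x2 c out, x = x1 ++ x2 ->
     cfg c o (tapes out (upd tp k (rev (cells x1), cells x2))) ->
     reach c (size x1 * loop_iter_time (run_time p0 (size x)) (run_time p1 (size x)) + 2)
       e (tapes (flatten [seq if b then den p1 x else den p0 x | b <- x1] ++ out)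
            (upd tp k ([::], None :: X))).
    elim/last_ind=> [|x1 b IH] x2 c' out' hx hcfg'.
      apply: reach_step => [|c2 h2]; first exact: step_move ho hcfg'.
      have := step_branch lo' ho' kD _ _ _ h2.
      rewrite eqxx /tapes /upd eqxx (gtn_eqF k0) /= => h3.
      apply: reach_step => [|c4 h4]; first by apply: h3; lia.
      apply: reach0; apply: cfg_equiv h4 _ => i _; have [->|//] := eqVneq i k.
      by rewrite (gtn_eqF k0) /X hx.
    apply: (@reach_le _ (1 + (1 + (run_time (if b then p1 else p0) (size x) + (1 +
         (size x1 * loop_iter_time (run_time p0 (size x)) (run_time p1 (size x)) + 2)))))).
      by rewrite size_rcons mulSn {2}/loop_iter_time; case: (b); lia.
    apply: reach_step => [|c2 h2]; first exact: step_move ho hcfg'.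
    have {}h2 : cfg c2 o.+1 (tapes out' (upd tp k (rev (cells x1), cells (b :: x2)))).
      apply: cfg_equiv h2 _ => i _; apply: tape_equiv_trans (tapes_upd_move _ _ _ _ _ k0) _.
      by rewrite /tape_move /= /cells map_rcons rev_rcons.
    have h3 := step_branch lo' ho' kD _ _ _ h2.
    apply: reach_step => [|c4]; first by apply: h3; lia.
    rewrite {1}/tapes {1}/upd (gtn_eqF k0) eqxx /= => h4.
    rewrite map_rcons flatten_rcons -catA.
    have hupd j : k.+1 <= j -> j <= D ->
        upd tp k (rev (cells x1), cells (b :: x2)) j = (rev X, [::]).
      by move=> kj jD; rewrite /upd gtn_eqF // htp //; lia.
    apply: (@reach_trans _ _ _ (if b then (e.-1) else (o.+2 + size c0)) _
      (tapes ((if b then den p1 x else den p0 x) ++ out')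
        (upd tp k (rev (cells x1), cells (b :: x2))))).
      case: b hx {hcfg' h2 h3} h4 hupd => hx h4 hupd.
        have -> : e.-1 = o1 + size c1 by rewrite /e; lia.
        exact: IH1 hc1 hupd h4.
      rewrite -(addn2 o); exact: IH0 hc0 hupd h4.
    move=> c5 h5.
    have {}h5 : cfg (tm_step c5) o (tapes ((if b then den p1 x else den p0 x) ++ out')
        (upd tp k (rev (cells x1), cells (b :: x2)))).
      case: b hx {hcfg' h2 h3 h4} h5 hupd => hx h5 hupd.
        rewrite -(prednK e0) in lj; have := step_branch lj hj kD _ _ _ h5.
        rewrite {1}/tapes {1}/upd (gtn_eqF k0) eqxx /=; apply; lia.
      have := step_branch lo'' ho'' kD _ _ _ h5.
      rewrite {1}/tapes {1}/upd (gtn_eqF k0) eqxx /=; apply; lia.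
    apply: reach_step h5 _ => c6 h6.
    by apply: IH h6; rewrite hx cat_rcons.
  apply: reach_trans.
    apply: (main x [::]); first by rewrite cats0.
    apply: cfg_equiv hcfg _ => i _; rewrite /tapes; case: eqP => // _.
    by rewrite /upd; case: eqP => // ->; rewrite htp.
  move=> c' h'.
  apply: reach_step => [|c2 h2]; first exact: step_move he h'.
  have {}h2 : cfg c2 e.+1 (tapes (den (PLoop p0 p1) x ++ out)
      (upd tp k (rev (cells [::]), cells x))).
    apply: cfg_equiv h2 _ => i _; apply: tape_equiv_trans (tapes_upd_move _ _ _ _ _ k0) _.
    rewrite /tapes /upd; case: eqP => // _; case: eqP => // _.
    (* The blank passed at the left end stays in the list of left cells, which is harmless up to
       [tape_equiv]. *)
    by split=> //= -[|[]].
  have [t ht h] := rewind_ok k0 kD eN he he' (erefl : x = [::] ++ x) h2.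
  exists t => //.
  apply: cfg_equiv h _ => i iD; rewrite /tapes; case: eqP => // _.
  by rewrite /upd; case: eqP => // ->; rewrite htp.
Qed.

(** [x1] has been copied and [x2] is still on tape 0; at the end the copies are in the resting
    position required by [comp_spec]. *)
Lemma init_ok c1 x1 x2 c : code_at 0 (IInit :: c1) -> x = x1 ++ x2 ->
  cfg c 0 (fun i => if i == 0 then ([::], cells x2) else (rev (cells x1), [::])) ->
  reach c (size x2).+1 1 (tapes [::] (fun _ => (rev X, [::]))).
Proof.
case/code_at_cons => l0 h0 _; elim: x2 x1 c => [|b x2 IH] x1 c hx hc.
  have h := step_init l0 h0 hc; apply: reach_step h _ => c' h'; apply: reach0.
  apply: cfg_equiv h' _ => i _; rewrite /tapes /X hx cats0; case: eqP => // _.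
  by split=> //= -[|[]].
have h := step_init l0 h0 hc; apply: reach_step h _ => c' h'.
apply: (IH (rcons x1 b)); first by rewrite hx cat_rcons.
apply: cfg_equiv h' _ => i _; case: eqP => //= _; last first.
  by rewrite /cells map_rcons rev_rcons.
by split=> // -[|j] //=; rewrite nth_nil.
Qed.

End Run.

Lemma cfg_halt (c : tm_config M) tf t : cfg c N tf -> iter t (@tm_step M) c = c.
Proof.
move=> [h _]; elim: t => [|t IH] //=; rewrite IH /tm_step /=.
by have -> : c.1 = ord_max :> 'I_N.+1 by [apply: val_inj]; rewrite eqxx.
Qed.

End Machine.

Lemma bits_of_tapeE (T : finType) (t : tape T) (s : seq bool) :
  (forall i, i < size s -> nth None t.2 i = Some (inl (nth false s i))) ->
  nth None t.2 (size s) = None -> bits_of_tape t = s.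
Proof.
case: t => l r /=; rewrite /bits_of_tape /=.
elim: s r => [|b s IH] [|c r] //= h.
- by move=> ->.
- by have := h 0 isT.
- by have /= -> := h 0 isT; move=> h'; rewrite IH // => i; apply: (h i.+1).
Qed.

(** The last instruction moves the head of tape 0 from the blank to the first output bit, from where
    [tm_run] reads the result. *)
Definition prog_code (p : prog) : seq instr :=
  IInit :: comp p 1 1 ++ [:: IMove 0 MoveRight].

Lemma code_at_full code : code_at code 0 code.
Proof. by split=> // i _; rewrite add0n. Qed.

Lemma prog_run (p : prog) (x : seq bool) t :
  (size x).+1 + (run_time p (size x) + 1) <= t ->
  tm_run (code_machine (depth p) (prog_code p)) [:: x] t = Some (den p x).
Proof.
move=> ht; set code := prog_code p.
have hcode := code_at_full code.
have [_ _ /code_at_cat[hp /code_at_cons[lm hm _]]] := code_at_cons hcode.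
have : reach (tm_init (code_machine (depth p) code) [:: x])
    ((size x).+1 + (run_time p (size x) + 1)) (size code)
    (fun i => if i == 0 then ([:: None], [seq Some (inl b) | b <- den p x]) else
        (rev [seq Some (inl b) | b <- x], [::])).
  apply: reach_trans.
    apply: (init_ok (x := x) hcode (erefl : x = [::] ++ x)); split=> //= i.
    rewrite ffunE -[_ == 0]/(i == ord0); case: eqP => [->//|/eqP].
    by case: i => -[|[|i]] //= hi _; rewrite /tape_of_bits /= nth_nil.
  move=> c' h'; apply: reach_trans.
    by apply: (comp_ok (x := x)) hp _ h'.
  move=> c2 h2; have h3 := step_move lm hm h2.
  apply: reach_step h3 _ => c4 h4; apply: reach0.
  rewrite /code /= size_cat addn1; apply: cfg_equiv h4 _ => i _.
  by rewrite /tapes cats0; case: eqP.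
case=> t' ht' hc; rewrite /tm_run.
rewrite -(subnK (leq_trans ht' ht)) iterD (cfg_halt _ hc).
have [h1 h2] := hc; have := h2 ord0; set c := iter _ _ _ in h1 h2 *.
have hh : c.1 = ord_max :> 'I_(size code).+1 by apply: val_inj.
rewrite /= hh eqxx => -[_ h]; congr Some; apply: bits_of_tapeE => [i hi|]; rewrite h /=.
  by rewrite (nth_map false).
by rewrite nth_default // size_map.
Qed.

(** * Polynomial bounds and words written by loop programs *)

Inductive poly_fun : (nat -> nat) -> Prop :=
  | poly_fun_const c : poly_fun (fun _ => c)
  | poly_fun_id : poly_fun (fun n => n)
  | poly_fun_add f g : poly_fun f -> poly_fun g -> poly_fun (fun n => f n + g n)
  | poly_fun_mul f g : poly_fun f -> poly_fun g -> poly_fun (fun n => f n * g n).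

Section PolyFun.
Import GRing.Theory.
Local Open Scope ring_scope.

(** Horner's scheme puts the time and coin bounds into the inductive form over which [generated_rep]
    proceeds. *)
Lemma poly_fun_horner (q : {poly nat}) :
  exists2 f, poly_fun f & forall n, f n = q.[n].
Proof.
elim/poly_ind: q => [|q c [f hf IH]].
  by exists (fun _ => 0%N); [constructor | move=> n; rewrite horner0].
exists (fun n => f n * n + c)%N => [|n]; first by repeat constructor.
by rewrite hornerMXaddC -IH.
Qed.

Lemma poly_fun_poly f : poly_fun f -> exists q : {poly nat}, forall n, q.[n] = f n.
Proof.
elim=> [c||{}f g _ [p hp] _ [q hq]|{}f g _ [p hp] _ [q hq]].
- by exists c%:P => n; rewrite hornerC.
- by exists 'X => n; rewrite hornerX.
- by exists (p + q) => n; rewrite hornerD hp hq.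
- by exists (p * q) => n; rewrite hornerM hp hq.
Qed.

End PolyFun.

Lemma poly_fun_run_time p : poly_fun (run_time p).
Proof.
elim: p => [s|p1 h1 p2 h2|p0 h0 p1 h1]; first exact: poly_fun_const.
  exact: poly_fun_add h2 h1.
have h c := poly_fun_const c; have hid := poly_fun_id.
exact: (poly_fun_add (poly_fun_add (poly_fun_mul hid
  (poly_fun_add (poly_fun_add h0 h1) (h 3))) (h 2))
  (poly_fun_add (h 1) (poly_fun_add (poly_fun_mul (h 2) hid) (h 1)))).
Qed.

Definition generated (f : seq bool -> seq bool) : Prop :=
  exists p, forall x, den p x = f x.

Lemma generated_poly_time f : generated f -> poly_time f.
Proof.
case=> p hp.
have [|q hq] := @poly_fun_poly (fun n => (n.+1) + (run_time p n + 1)).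
  have h1 := poly_fun_const 1.
  exact: (poly_fun_add (poly_fun_add h1 poly_fun_id)
    (poly_fun_add (poly_fun_run_time p) h1)).
exists (code_machine (depth p) (prog_code p)), q => x.
by rewrite -hp; apply: prog_run; rewrite hq.
Qed.

Lemma generated_eq f g : f =1 g -> generated f -> generated g.
Proof. by move=> h [p hp]; exists p => x; rewrite hp h. Qed.

Lemma generated_const s : generated (fun _ => s).
Proof. by exists (PEmit s). Qed.

Lemma generated_cat f g :
  generated f -> generated g -> generated (fun x => f x ++ g x).
Proof. by move=> [p hp] [q hq]; exists (PCat p q) => x /=; rewrite hp hq. Qed.

Lemma generated_bits f g : generated f -> generated g ->
  generated (fun x => flatten [seq if b then g x else f x | b <- x]).
Proof. by move=> [p hp] [q hq]; exists (PLoop p q) => x /=; rewrite hp hq. Qed.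

Lemma flatten_nseq_nseq (T : Type) a b (s : seq T) :
  flatten (nseq a (flatten (nseq b s))) = flatten (nseq (a * b) s).
Proof. by elim: a => //= a ->; rewrite mulSn nseqD flatten_cat. Qed.

(** Counting by control structure: a loop with two equal bodies repeats [size x] times,
    concatenation adds repetition counts and nesting multiplies them. *)
Lemma generated_rep k f : poly_fun k -> generated f ->
  generated (fun x => flatten (nseq (k (size x)) (f x))).
Proof.
move=> hk; elim: hk f => {k} [c||k1 k2 _ IH1 _ IH2|k1 k2 _ IH1 _ IH2] f hf.
- elim: c => [|c IH] /=; first exact: generated_const.
  exact: generated_cat.
- apply: generated_eq (generated_bits hf hf) => x; congr flatten.
  by move: (f x) => s; elim: x => //= b x ->; case: b.
- apply: generated_eq (generated_cat (IH1 _ hf) (IH2 _ hf)) => x.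
  by rewrite nseqD flatten_cat.
- by apply: generated_eq (IH1 _ (IH2 _ hf)) => x; rewrite flatten_nseq_nseq.
Qed.

Lemma flatten_nseq1 (T : Type) n (a : T) : flatten (nseq n [:: a]) = nseq n a.
Proof. by elim: n => //= n ->. Qed.

Lemma generated_nseq k b : poly_fun k -> generated (fun x => nseq (k (size x)) b).
Proof.
move=> hk; apply: generated_eq (generated_rep hk (generated_const [:: b])) => x.
exact: flatten_nseq1.
Qed.

(** * Circuits made of equal blocks *)

Lemma wires_cat gs1 gs2 w : wires (gs1 ++ gs2) w = wires gs2 (wires gs1 w).
Proof. exact: foldl_cat. Qed.

(** Every gate puts one wire in front, so old wires move away by the number of gates added. All the
    address computations below rest on this. *)
Lemma wire_shift gs w i : wire (wires gs w) (size gs + i) = wire w i.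
Proof.
elim: gs w i => [|g gs IH] w i //.
have -> : size (g :: gs) + i = size gs + i.+1 by rewrite addnS.
exact: (IH (gate_val w g :: w)).
Qed.

Fixpoint dtree_size (m : nat) : nat :=
  if m is m'.+1 then dtree_size m' + dtree_size m' + 4 else 1.

(* Shannon expansion of [h]; the variables [vs] are the names that the wires
   had [d] gates earlier. *)
Fixpoint dtree (d : nat) (vs : seq nat) (h : seq bool -> bool) : seq gate :=
  if vs is a :: vs' then
    let s := dtree_size (size vs') in
    let a' := a + (d + (s + s)) in
    dtree d vs' (fun bs => h (true :: bs)) ++
    dtree (d + s) vs' (fun bs => h (false :: bs)) ++
    [:: GNot a'; GAnd 0 1; GAnd (2 + a') (2 + s); GOr 0 1]
  else [:: GConst (h [::])].

Lemma size_dtree d vs h : size (dtree d vs h) = dtree_size (size vs).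
Proof.
by elim: vs d h => [|a vs IH] d h //=; rewrite !size_cat !IH /= addnA.
Qed.

Lemma dtree_ok d vs h w :
  wire (wires (dtree d vs h) w) 0 = h [seq wire w (a + d) | a <- vs].
Proof.
elim: vs d h w => [|a vs IH] d h w //=.
rewrite !wires_cat; set s := dtree_size _.
set w1 := wires _ w; set w2 := wires _ w1.
have e d' h' w' i : wire (wires (dtree d' vs h') w') (s + i) = wire w' i.
  by have := wire_shift (dtree d' vs h') w' i; rewrite size_dtree.
have e1 i : wire w1 (s + i) = wire w i by apply: e.
have e2 i : wire w2 (s + i) = wire w1 i by apply: e.
have v2 : wire w2 0 = h (false :: [seq wire w (a + d) | a <- vs]).
  rewrite IH; congr (h (_ :: _)); apply: eq_map => b.
  by rewrite -e1; congr (wire _ _); lia.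
have v1 : wire w2 s = h (true :: [seq wire w (a + d) | a <- vs]).
  by rewrite -[s]addn0 e2 IH.
have va : wire w2 (a + (d + (s + s))) = wire w (a + d).
  by rewrite -e1 -e2; congr (wire _ _); lia.
(* The last four gates compute the multiplexer of the two subtrees. The offset 2 in the third one
   accounts for the two gates just emitted. *)
transitivity (wire w2 (a + (d + (s + s))) && wire w2 s
  || ~~ wire w2 (a + (d + (s + s))) && wire w2 0); first by [].
by rewrite va v1 v2; case: (wire w _); rewrite ?orbF.
Qed.

(** The tree of the first function comes last, so that its output is wire 0 and the other outputs
    follow at equal distances. The first argument of [dtree] skips the gates already emitted in this
    block. *)
Fixpoint block (vs : seq nat) (hs : seq (seq bool -> bool)) : seq gate :=
  if hs is h :: hs' then
    block vs hs' ++ dtree (size hs' * dtree_size (size vs)) vs h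
  else [::].

Lemma size_block vs hs : size (block vs hs) = size hs * dtree_size (size vs).
Proof. by elim: hs => //= h hs IH; rewrite size_cat IH size_dtree mulSn addnC. Qed.

Lemma block_ok vs hs w i : i < size hs ->
  wire (wires (block vs hs) w) (i * dtree_size (size vs)) =
    nth (fun _ => false) hs i [seq wire w a | a <- vs].
Proof.
elim: hs i => [|h hs IH] [|i] // hi; rewrite [block _ _]/= wires_cat.
  rewrite mul0n dtree_ok; congr (h _); apply: eq_map => a.
  by rewrite addnC -size_block wire_shift.
set d := _ * _; set w1 := wires _ w.
by have := wire_shift (dtree d vs h) w1 (i * dtree_size (size vs));
  rewrite size_dtree mulSn => ->; rewrite IH.
Qed.

(** * Gate lists written by loop programs *)

Section GeneratedGates.

(** [enc_seq enc_gate] without its end marker, which makes it compatible with concatenation. *)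
Definition enc_gates (gs : seq gate) : seq bool :=
  flatten [seq true :: enc_gate g | g <- gs].

Lemma enc_gates_cat gs1 gs2 : enc_gates (gs1 ++ gs2) = enc_gates gs1 ++ enc_gates gs2.
Proof. by rewrite /enc_gates map_cat flatten_cat. Qed.

Lemma enc_gates_rep n gs : enc_gates (flatten (nseq n gs)) = flatten (nseq n (enc_gates gs)).
Proof. by elim: n => //= n IH; rewrite enc_gates_cat IH. Qed.

Lemma generated_enc_nat f : poly_fun f -> generated (fun x => enc_nat (f (size x))).
Proof.
move=> hf; apply: generated_eq (generated_cat (generated_nseq true hf)
  (generated_const [:: false])) => x.
by rewrite cats1.
Qed.

Definition generated_gates (gs : seq bool -> seq gate) : Prop :=
  generated (fun x => enc_gates (gs x)).

Lemma generated_gates_eq f g : f =1 g -> generated_gates f -> generated_gates g.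
Proof. by move=> h; apply: generated_eq => x; rewrite h. Qed.

Lemma generated_gates_cat f g : generated_gates f -> generated_gates g ->
  generated_gates (fun x => f x ++ g x).
Proof.
by move=> hf hg; apply: generated_eq (generated_cat hf hg) => x; rewrite enc_gates_cat.
Qed.

Lemma generated_gates_rep k f : poly_fun k -> generated_gates f ->
  generated_gates (fun x => flatten (nseq (k (size x)) (f x))).
Proof.
by move=> hk hf; apply: generated_eq (generated_rep hk hf) => x; rewrite enc_gates_rep.
Qed.

Lemma generated_gates_bits f g : generated_gates f -> generated_gates g ->
  generated_gates (fun x => flatten [seq if b then g x else f x | b <- x]).
Proof.
move=> hf hg; apply: generated_eq (generated_bits hf hg) => x.
by move: (f x) (g x) => u v; elim: x => //= b x ->; rewrite enc_gates_cat; case: b.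
Qed.

Lemma generated_gate_const b : generated_gates (fun _ => [:: GConst b]).
Proof. exact: generated_const. Qed.

Lemma generated_gate_not i : poly_fun i ->
  generated_gates (fun x => [:: GNot (i (size x))]).
Proof.
move=> hi; apply: generated_eq (generated_cat
  (generated_const [:: true; false; true]) (generated_enc_nat hi)) => x.
by rewrite /enc_gates /= cats0.
Qed.

Lemma generated_gate_and i j : poly_fun i -> poly_fun j ->
  generated_gates (fun x => [:: GAnd (i (size x)) (j (size x))]).
Proof.
move=> hi hj; apply: generated_eq (generated_cat
  (generated_const [:: true; true; false])
  (generated_cat (generated_enc_nat hi) (generated_enc_nat hj))) => x.
by rewrite /enc_gates /= cats0.
Qed.

Lemma generated_gate_or i j : poly_fun i -> poly_fun j ->
  generated_gates (fun x => [:: GOr (i (size x)) (j (size x))]).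
Proof.
move=> hi hj; apply: generated_eq (generated_cat
  (generated_const [:: true; true; true])
  (generated_cat (generated_enc_nat hi) (generated_enc_nat hj))) => x.
by rewrite /enc_gates /= cats0.
Qed.

(** Address lists of constant length with polynomially growing entries: the trees built on them keep
    a constant shape, and only the wire names depend on the size of the input. *)
Inductive poly_seq : (nat -> seq nat) -> Prop :=
  | poly_seq_nil : poly_seq (fun _ => [::])
  | poly_seq_cons f v : poly_fun f -> poly_seq v -> poly_seq (fun n => f n :: v n).

Lemma poly_seq_size v : poly_seq v -> exists m, forall n, size (v n) = m.
Proof.
elim=> [|f {}v _ _ [m hm]]; first by exists 0.
by exists m.+1 => n /=; rewrite hm.
Qed.

Lemma generated_dtree d vs h : poly_fun d -> poly_seq vs ->
  generated_gates (fun x => dtree (d (size x)) (vs (size x)) h).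
Proof.
move=> hd hvs; elim: hvs d hd h => {vs} [|a vs ha hvs IH] d hd h.
  exact: generated_gate_const.
have [m hm] := poly_seq_size hvs; pose s := dtree_size m.
have c k := poly_fun_const k.
have ha' := poly_fun_add ha (poly_fun_add hd (c (s + s))).
apply: generated_gates_eq (generated_gates_cat (IH d hd _) (generated_gates_cat
  (IH _ (poly_fun_add hd (c s)) _) (generated_gates_cat (generated_gate_not ha')
  (generated_gates_cat (generated_gate_and (c 0) (c 1)) (generated_gates_cat
   (generated_gate_and (poly_fun_add (c 2) ha') (c (2 + s)))
   (generated_gate_or (c 0) (c 1))))))) => x.
by rewrite /= hm.
Qed.

Lemma generated_block vs hs : poly_seq vs ->
  generated_gates (fun x => block (vs (size x)) hs).
Proof.
move=> hvs; elim: hs => [|h hs IH]; first exact: generated_const.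
have [m hm] := poly_seq_size hvs.
have := generated_dtree h (poly_fun_const (size hs * dtree_size m)) hvs.
move=> /(generated_gates_cat IH); apply: generated_gates_eq => x.
by rewrite /= hm.
Qed.

Lemma poly_seq_cat v1 v2 : poly_seq v1 -> poly_seq v2 ->
  poly_seq (fun n => v1 n ++ v2 n).
Proof. by move=> h1 h2; elim: h1 => //= f v hf _ IH; apply: (poly_seq_cons hf). Qed.

Lemma poly_seq_map (T : Type) (f : T -> nat -> nat) (s : seq T) :
  (forall i, poly_fun (f i)) -> poly_seq (fun n => [seq f i n | i <- s]).
Proof.
move=> hf; elim: s => [|a s IH] /=; first exact: poly_seq_nil.
exact: (poly_seq_cons (hf a)).
Qed.

End GeneratedGates.

(** * Rows of one-hot encoded cells computed by local rules *)

Section Cells.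

Variables (S : finType) (v0 : S).

Let B := #|S|.

Definition one_hot (v : S) : seq bool := [seq u == v | u <- enum S].

Definition of_one_hot (bs : seq bool) : S :=
  odflt v0 [pick v | one_hot v == bs].

Lemma size_one_hot v : size (one_hot v) = B.
Proof. by rewrite size_map -cardE. Qed.

Lemma one_hotK : cancel one_hot of_one_hot.
Proof.
move=> v; rewrite /of_one_hot; case: pickP => [u /eqP /= h|/(_ v)]; last by rewrite eqxx.
have /eq_in_map /(_ v) : one_hot u = one_hot v by [].
by rewrite mem_enum eqxx => /(_ isT) /eqP ->.
Qed.

(** The number of gates of a tree over the variables of a rule, four cells and one wire; consecutive
    wires of a cell are that far apart. *)
Definition stride : nat := dtree_size (B + (B + (B + (B + 1)))).
Definition cell_size : nat := B * stride.

Definition cell_addr (i : nat) : seq nat :=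
  [seq i * cell_size + b * stride | b <- iota 0 B].

Lemma size_cell_addr i : size (cell_addr i) = B.
Proof. by rewrite size_map size_iota. Qed.

Definition read_cell (w : seq bool) (i : nat) : S :=
  of_one_hot [seq wire w a | a <- cell_addr i].

(* The arguments are the preceding block, the cells to the left, at, and to the
   right of the same position in the previous row, and a wire of the rule's
   choice. *)
Definition rule := S -> S -> S -> S -> bool -> S.

(** A row has [W.+2] cells, so just before a cell is emitted, the cell above it is block [W.+1]
    counted back from 0. At the ends of a row some of these addresses leave the row. *)
Definition rule_vars (W r : nat) : seq nat :=
  cell_addr 0 ++ cell_addr W.+2 ++ cell_addr W.+1 ++ cell_addr W ++ [:: r].

Definition rule_fun (G : rule) (bs : seq bool) : seq bool :=
  let get k := of_one_hot (take B (drop (k * B) bs)) in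
  one_hot (G (get 0) (get 1) (get 2) (get 3) (nth false bs (4 * B))).

Definition rule_block (W r : nat) (G : rule) : seq gate :=
  block (rule_vars W r) (mkseq (fun b bs => nth false (rule_fun G bs) b) B).

Lemma dtree_size_rule_vars W r : dtree_size (size (rule_vars W r)) = stride.
Proof. by rewrite !size_cat !size_cell_addr. Qed.

Lemma size_rule_block W r G : size (rule_block W r G) = cell_size.
Proof. by rewrite size_block dtree_size_rule_vars size_mkseq. Qed.

Lemma wire_rule_block W r G w i :
  wire (wires (rule_block W r G) w) (cell_size + i) = wire w i.
Proof. by rewrite -(size_rule_block W r G) wire_shift. Qed.

Lemma read_rule_blockS W r G w i :
  read_cell (wires (rule_block W r G) w) i.+1 = read_cell w i.
Proof.
rewrite /read_cell /cell_addr -!map_comp; congr of_one_hot; apply: eq_map => b /=.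
by rewrite mulSn -addnA wire_rule_block.
Qed.

Lemma read_rule_block0 W r G w :
  read_cell (wires (rule_block W r G) w) 0 =
  G (read_cell w 0) (read_cell w W.+2) (read_cell w W.+1) (read_cell w W) (wire w r).
Proof.
rewrite -[RHS]one_hotK /read_cell; congr of_one_hot.
set bs := [seq wire w a | a <- rule_vars W r].
have <- : rule_fun G bs = one_hot (G (read_cell w 0) (read_cell w W.+2)
   (read_cell w W.+1) (read_cell w W) (wire w r)).
  have sz i : size [seq wire w a | a <- cell_addr i] = B by rewrite size_map size_cell_addr.
  have get (s t : seq bool) k : size s = B ->
      (take B (drop (0 * B) (s ++ t)) = s) * (drop (k.+1 * B) (s ++ t) = drop (k * B) t).
    move=> hs; split; first by rewrite drop0 -hs take_size_cat.
    by rewrite drop_cat hs mulSn ltnNge leq_addr addKn.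
  rewrite /rule_fun /bs /rule_vars !map_cat; congr (one_hot (G _ _ _ _ _)).
  - by rewrite get.
  - by rewrite !get.
  - by rewrite !get.
  - by rewrite !get.
  rewrite !catA nth_cat !size_cat !sz.
  have -> : 4 * B = B + B + B + B by lia.
  by rewrite ltnn subnn.
rewrite -map_comp; apply: (@eq_from_nth _ false) => [|b].
  by rewrite size_map size_iota size_one_hot.
rewrite size_map size_iota => hb; rewrite (nth_map 0) ?size_iota //= nth_iota //.
rewrite mul0n !add0n -(dtree_size_rule_vars W r) block_ok ?size_mkseq //.
by rewrite nth_mkseq.
Qed.

Section Pass.

Variable W : nat.

(* The row has [W.+2] cells, and blocks are numbered from the last one back. *)
Definition row (w : seq bool) (j : nat) : S := read_cell w (W.+1 - j).

Definition pass (ops : seq (nat * rule)) : seq gate :=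
  flatten [seq rule_block W op.1 op.2 | op <- ops].

Lemma pass_cat ops1 ops2 : pass (ops1 ++ ops2) = pass ops1 ++ pass ops2.
Proof. by rewrite /pass map_cat flatten_cat. Qed.

Lemma pass_nseq n op : pass (nseq n op) = flatten (nseq n (rule_block W op.1 op.2)).
Proof. by rewrite /pass map_nseq. Qed.

Lemma size_pass ops : size (pass ops) = size ops * cell_size.
Proof.
elim: ops => //= op ops IH; rewrite /pass /= size_cat size_rule_block.
by rewrite -/(pass ops) IH mulSn.
Qed.

Lemma read_pass ops w i : read_cell (wires (pass ops) w) (size ops + i) = read_cell w i.
Proof.
elim: ops w i => [|op ops IH] w i //; rewrite /pass /= wires_cat -/(pass ops).
by rewrite addSnnS IH read_rule_blockS.
Qed.

Lemma wire_pass ops w i : wire (wires (pass ops) w) (size ops * cell_size + i) = wire w i.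
Proof. by rewrite -size_pass wire_shift. Qed.

(** The rule's arguments are existential because they are controlled only where the neighbour lies
    in the row. The address of [b] is shifted by the [j] blocks emitted before it is read. *)
Lemma row_pass ops w j op0 : size ops = W.+2 -> j < W.+2 ->
  let w' := wires (pass ops) w in
  let op := nth op0 ops j in
  exists c l r b, [/\ row w' j = op.2 c l (row w j) r b,
    0 < j -> c = row w' j.-1 /\ l = row w j.-1,
    j < W.+1 -> r = row w j.+1 &
    forall i, op.1 = j * cell_size + i -> b = wire w i].
Proof.
move=> sz hj w' op.
have e : ops = take j ops ++ op :: drop j.+1 ops.
  by rewrite -drop_nth ?sz // cat_take_drop.
have st : size (take j ops) = j by rewrite size_take sz hj.
have sd : size (drop j.+1 ops) = W.+1 - j by rewrite size_drop sz subSS.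
(* The wires present just before block [j] is emitted. *)
set wj := wires (pass (take j ops)) w.
have ew : w' = wires (pass (drop j.+1 ops)) (wires (rule_block W op.1 op.2) wj).
  by rewrite /w' {1}e pass_cat wires_cat /pass /= wires_cat.
have rj i : read_cell wj (j + i) = read_cell w i by rewrite -{1}st read_pass.
exists (read_cell wj 0), (read_cell wj W.+2), (read_cell wj W), (wire wj op.1); split.
- rewrite {1}/row -sd -[size _]addn0 ew read_pass read_rule_block0.
  by congr (op.2 _ _ _ _ _); rewrite /row -rj; congr (read_cell _ _); lia.
- move=> j0; split; last by rewrite /row -rj; congr (read_cell _ _); lia.
  rewrite /row ew (_ : W.+1 - j.-1 = size (drop j.+1 ops) + 1); last by lia.
  by rewrite read_pass read_rule_blockS.
- by move=> hj'; rewrite /row -rj; congr (read_cell _ _); lia.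
- by move=> i ->; rewrite -{1}st wire_pass.
Qed.

End Pass.

End Cells.

(** * Simulation of a Turing machine *)

Section GeneratedRule.

Variables (S : finType) (v0 : S).

Lemma poly_seq_cell_addr i : poly_fun i -> poly_seq (fun n => cell_addr S (i n)).
Proof.
move=> hi; apply: (@poly_seq_map _ (fun b n => i n * cell_size S + b * stride S)) => b.
exact: poly_fun_add (poly_fun_mul hi (poly_fun_const _)) (poly_fun_const _).
Qed.

Lemma generated_rule_block W r G : poly_fun W -> poly_fun r ->
  generated_gates (fun x => rule_block v0 (W (size x)) (r (size x)) G).
Proof.
move=> hW hr; apply: (@generated_block (fun n => rule_vars S (W n) (r n))).
have h k := poly_fun_add (poly_fun_const k) hW.
exact: (poly_seq_cat (poly_seq_cell_addr (poly_fun_const 0))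
  (poly_seq_cat (poly_seq_cell_addr (h 2)) (poly_seq_cat (poly_seq_cell_addr (h 1))
  (poly_seq_cat (poly_seq_cell_addr hW) (poly_seq_cons hr poly_seq_nil))))).
Qed.

End GeneratedRule.

Section Simulation.

Variable M : turing_machine.

Let K := tm_tapes M.
Let cellM : finType := cell (tm_sym M).

(** A copy of [move] in a finite type, so that cells can record actions. *)
Definition move_code (m : move) : option bool :=
  match m with MoveLeft => Some true | MoveStay => None | MoveRight => Some false end.

Definition actions : finType := {ffun 'I_K.+1 -> cellM * option bool}.

(* The cell at distance [j] from the heads: the state, the actions that led to
   the present row, and the contents of the [j]-th cells to the left and to the
   right of the heads. *)
Definition simcell : finType :=
  (tm_state M * actions * {ffun 'I_K.+1 -> cellM} * {ffun 'I_K.+1 -> cellM})%type.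

Definition sc_state (v : simcell) : tm_state M := v.1.1.1.
Definition sc_act (v : simcell) : actions := v.1.1.2.
Definition sc_left (v : simcell) : {ffun 'I_K.+1 -> cellM} := v.1.2.
Definition sc_right (v : simcell) : {ffun 'I_K.+1 -> cellM} := v.2.

Lemma sc_leftE qa L R : sc_left (qa, L, R) = L. Proof. by []. Qed.

Lemma sc_rightE qa L R : sc_right (qa, L, R) = R. Proof. by []. Qed.

(** Halting is expressed as writing back the symbols read without moving, so the circuit needs no
    separate case for it. *)
Definition control (q : tm_state M) (reads : {ffun 'I_K.+1 -> cellM}) :
    tm_state M * actions :=
  if tm_halt q then (q, [ffun i => (reads i, None)])
  else let: (q', a) := tm_trans q reads in
       (q', [ffun i => ((a i).1, move_code (a i).2)]).

(** In coordinates relative to the head, a new cell depends on its old neighbours and on the action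
    only. The symbol just written can end up at distance 0 or 1, whence the separate rules for
    distances 0, 1 and at least 2. *)
Lemma tm_step_control (c : tm_config M) :
  let qa := control c.1 [ffun i => tape_read (c.2 i)] in
  (tm_step c).1 = qa.1 /\ forall i j,
    (nth None ((tm_step c).2 i).1 j = match (qa.2 i).2 with
      | Some true => nth None (c.2 i).1 j.+1
      | None => nth None (c.2 i).1 j
      | Some false => if j is j'.+1 then nth None (c.2 i).1 j' else (qa.2 i).1
      end) /\
    (nth None ((tm_step c).2 i).2 j = match (qa.2 i).2 with
      | Some true => if j is j'.+1 then if j' is _.+1 then nth None (c.2 i).2 j'
                     else (qa.2 i).1 else nth None (c.2 i).1 0
      | None => if j is _.+1 then nth None (c.2 i).2 j else (qa.2 i).1
      | Some false => nth None (c.2 i).2 j.+1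
      end).
Proof.
rewrite /control /tm_step; case: ifP => _ /=.
  split=> // i j; rewrite !ffunE /=; split=> //.
  by rewrite tape_read_nth; case: j.
case: (tm_trans _ _) => q a /=; split=> // i j; rewrite !ffunE /=.
rewrite !nth_tape_write_move; case: (a i) => s [] /=; split=> //; case: j => // -[] //.
Qed.

Definition rule_head : rule simcell := fun _ _ o r _ =>
  let qa := control (sc_state o) (sc_right o) in
  (qa,
   [ffun i => match (qa.2 i).2 with
     Some true => sc_left r i | None => sc_left o i | Some false => (qa.2 i).1 end],
   [ffun i => match (qa.2 i).2 with
     Some true => sc_left o i | None => (qa.2 i).1 | Some false => sc_right r i end]).

Definition rule_next : rule simcell := fun c l o r _ =>
  (c.1.1,
   [ffun i => match (sc_act c i).2 with
     Some true => sc_left r i | None => sc_left o i | Some false => sc_left l i end],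
   [ffun i => match (sc_act c i).2 with
     Some true => (sc_act c i).1 | None => sc_right o i | Some false => sc_right r i end]).

Definition rule_far : rule simcell := fun c l o r _ =>
  (c.1.1,
   [ffun i => match (sc_act c i).2 with
     Some true => sc_left r i | None => sc_left o i | Some false => sc_left l i end],
   [ffun i => match (sc_act c i).2 with
     Some true => sc_right l i | None => sc_right o i | Some false => sc_right r i end]).

Definition row_ok (c : tm_config M) (j : nat) (v : simcell) : Prop :=
  sc_state v = c.1 /\ forall i, sc_left v i = nth None (c.2 i).1 j /\
                                sc_right v i = nth None (c.2 i).2 j.

Definition blank_cell (s : cellM) : simcell :=
  (tm_start M, [ffun=> (None, None)], [ffun=> None],
   [ffun i => if i == ord0 then s else None]).

Let v0 := blank_cell None.

Definition step_ops (W : nat) : seq (nat * rule simcell) :=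
  (0, rule_head) :: (0, rule_next) :: nseq W (0, rule_far).

(** The last cell of a row has no right neighbour in it, so one correct cell is lost at the right
    end in each step. At the left end nothing is lost, as [rule_head] ignores [c] and [l]. *)
Lemma step_ops_ok W t c w : t < W.+2 ->
  (forall j, j + t < W.+2 -> row_ok c j (row v0 W w j)) ->
  let w' := wires (pass v0 W (step_ops W)) w in
  forall j, j + t.+1 < W.+2 -> row_ok (tm_step c) j (row v0 W w' j).
Proof.
move=> tW hrow w'.
have sz : size (step_ops W) = W.+2 by rewrite /= size_nseq.
pose qa := control c.1 [ffun i => tape_read (c.2 i)].
(* The chosen transition reaches every cell of the new row, handed on from the preceding block, even
   where the tape contents are no longer correct. *)
have hc j : j < W.+2 -> (row v0 W w' j).1.1 = qa.
  elim: j => [|j IH] hj.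
    have [cc [l [r [b [-> _ _ _]]]]] := row_pass v0 w (0, rule_head) sz hj.
    have [h0 h] := hrow 0 tW.
    transitivity (control (sc_state (row v0 W w 0)) (sc_right (row v0 W w 0))).
      by rewrite /= /rule_head; case: (control _ _).
    rewrite h0; congr (control _ _).
    by apply/ffunP => i; rewrite ffunE; have [_ ->] := h i; rewrite tape_read_nth.
  have [cc [l [r [b [-> /(_ isT) [ec _] _ _]]]]] := row_pass v0 w (0, rule_head) sz hj.
  rewrite -(IH (ltnW hj)) -ec; move: hj; case: (j) => [|j'] //= hj.
  by rewrite nth_nseq (_ : j' < W).
have [hq hs] := tm_step_control c.
move=> j hj; have hj' : j < W.+2 by lia.
split; first by rewrite /sc_state hc // hq.
have [cc [l [r [b [e hcl hr _]]]]] := row_pass v0 w (0, rule_head) sz hj'.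
have {}hr : row_ok c j.+1 r by rewrite hr; [apply: hrow; lia | lia].
have ho : row_ok c j (row v0 W w j) by apply: hrow; lia.
move=> i; have [-> ->] := hs i j; rewrite -/qa -/w' in e *.
have [_ /(_ i) [r1 r2]] := hr; have [_ /(_ i) [o1 o2]] := ho.
case: j hj hj' hcl e {hr ho} r1 r2 o1 o2 => [|j] hj hj' hcl e r1 r2 o1 o2.
  have eqa : control (sc_state (row v0 W w 0)) (sc_right (row v0 W w 0)) = qa.
    by rewrite -(hc 0 hj') e.
  rewrite e /rule_head /= !(sc_leftE, sc_rightE) !ffunE.
  by rewrite !eqa r1 r2 o1; case: (qa.2 i).2 => [[]|].
have [ec el] := hcl isT.
have ea : sc_act cc = qa.2 by rewrite /sc_act ec -/w' hc //; lia.
have [_ /(_ i) [l1 l2]] : row_ok c j l by rewrite el; apply: hrow => /=; lia.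
case: j hj hj' hcl e r1 r2 o1 o2 ec el l1 l2 => [|j] hj hj' hcl e r1 r2 o1 o2 ec el l1 l2.
  rewrite e /= /rule_next !(sc_leftE, sc_rightE) !ffunE ea.
  by rewrite r1 r2 o1 o2 l1; case: (qa.2 i).2 => [[]|].
have efar : nth (0, rule_head) (step_ops W) j.+2 = (0, rule_far).
  by rewrite /= nth_nseq; case: ifP => //; lia.
rewrite efar in e.
rewrite e /= /rule_far !(sc_leftE, sc_rightE) !ffunE ea.
by rewrite r1 r2 o1 o2 l1 l2; case: (qa.2 i).2 => [[]|].
Qed.

Definition rule_const (v : simcell) : rule simcell := fun _ _ _ _ _ => v.

Definition rule_copy : rule simcell := fun _ _ o _ _ => o.

Definition rule_coin : rule simcell := fun _ _ o _ b =>
  (o.1, [ffun i : 'I_K.+1 => if i == 1 :> nat then Some (inl b) else sc_right o i]).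

Definition rule_input (b : bool) : rule simcell := rule_const (blank_cell (Some (inl b))).

Section Rows.

Variables (P T : nat) (x : seq bool).

Let n := size x.
(** Room for the input and the coins, and for the cell lost in each of the [T] steps; cells 0 and 1
    are still correct at the end. *)
Let W := n + P + T.

Definition input_ops : seq (nat * rule simcell) :=
  [seq (0, rule_input b) | b <- x] ++ nseq (P + T).+2 (0, rule_const v0).

(* Every block adds [cell_size] wires, so this fixed address goes back through
   the input, from one coin to the preceding one. *)
Definition coin_addr : nat := (W.+2 + P) * cell_size simcell + 2.

Definition coin_ops : seq (nat * rule simcell) :=
  nseq P (coin_addr, rule_coin) ++ nseq (n + T).+2 (0, rule_copy).

Definition sim_gates : seq gate :=
  pass v0 W input_ops ++ pass v0 W coin_ops ++ flatten (nseq T (pass v0 W (step_ops W))).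

(* The first two input wires hold the action. *)
Definition coins (inp : seq bool) : seq bool :=
  mkseq (fun j => wire inp ((P - j) * cell_size simcell + 2)) P.

Lemma input_row w j : j < W.+2 ->
  row v0 W (wires (pass v0 W input_ops) w) j =
    blank_cell (nth None [seq Some (inl b) | b <- x] j).
Proof.
move=> hj; have sz : size input_ops = W.+2.
  by rewrite size_cat size_map size_nseq /W /n; lia.
have [c [l [r [b [-> _ _ _]]]]] := row_pass v0 w (0, rule_const v0) sz hj.
rewrite /input_ops nth_cat size_map; case: ltnP => hjx.
  by rewrite !(nth_map false).
rewrite nth_nseq [in RHS]nth_default ?size_map //.
by case: ifP.
Qed.

Lemma coin_row inp j : j < W.+2 ->
  let w1 := wires (pass v0 W input_ops) inp in
  row_ok (tm_init M [:: x; coins inp]) j (row v0 W (wires (pass v0 W coin_ops) w1) j).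
Proof.
move=> hj w1; have sz : size coin_ops = W.+2.
  by rewrite size_cat !size_nseq /W /n; lia.
have sz1 : size input_ops = W.+2.
  by rewrite size_cat size_map size_nseq /W /n; lia.
have [c [l [r [b [-> _ _ hb]]]]] := row_pass v0 w1 (0, rule_copy) sz hj.
rewrite input_row //; move: hb.
rewrite /coin_ops nth_cat size_nseq nth_nseq; case: ltnP => hjP.
  (* At block [j] the fixed [coin_addr] goes back over [j] blocks of this pass, the [W.+2] blocks of
     the input pass, and then [P - j] block lengths into the input wires. *)
  move=> /= /(_ (W.+2 * cell_size simcell + ((P - j) * cell_size simcell + 2))) hb.
  have {hb} -> : b = wire inp ((P - j) * cell_size simcell + 2).
    rewrite hb; last by rewrite /coin_addr addnA -mulnDl addnA -mulnDl; congr (_ * _ + _); lia.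
    by rewrite -sz1 wire_pass.
  split=> // i; rewrite /tm_init /sc_left /sc_right /= !ffunE nth_nil; split=> //.
  case: i => -[|[|i]] hi /=.
  - by [].
  - by rewrite (nth_map false) ?size_mkseq // nth_mkseq.
  - by rewrite !nth_nil.
move=> _; have -> : nth (0, rule_copy) (nseq (n + T).+2 (0, rule_copy)) (j - P) =
    (0, rule_copy).
  by rewrite nth_nseq; case: ifP.
split=> // i; rewrite /tm_init /sc_left /sc_right /= !ffunE nth_nil; split=> //.
case: i => -[|[|i]] hi //=.
- by rewrite nth_default // size_map size_mkseq.
- by rewrite !nth_nil.
Qed.

Lemma sim_row inp j : j + T < W.+2 ->
  row_ok (iter T (@tm_step M) (tm_init M [:: x; coins inp])) j
    (row v0 W (wires sim_gates inp) j).
Proof.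
move=> hj; rewrite /sim_gates !wires_cat.
set w2 := wires _ (wires _ inp).
have h0 i : i + 0 < W.+2 -> row_ok (tm_init M [:: x; coins inp]) i (row v0 W w2 i).
  by rewrite addn0; apply: coin_row.
have hT : T < W.+2 by rewrite /W; lia.
have h t : t <= T -> forall i, i + t < W.+2 ->
    row_ok (iter t (@tm_step M) (tm_init M [:: x; coins inp])) i
      (row v0 W (wires (flatten (nseq t (pass v0 W (step_ops W)))) w2) i).
  elim: t => [|t IH] htT i hi; first exact: h0.
  have -> : nseq t.+1 (pass v0 W (step_ops W)) =
      rcons (nseq t (pass v0 W (step_ops W))) (pass v0 W (step_ops W)).
    by elim: (t) => //= m {1}->.
  rewrite flatten_rcons wires_cat iterS.
  by apply: step_ops_ok hi; [lia | exact: IH (ltnW htT)].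
exact: h hj.
Qed.

Lemma size_sim_gates : size sim_gates = T.+2 * (W.+2 * cell_size simcell).
Proof.
have sf m (s : seq gate) : size (flatten (nseq m s)) = m * size s.
  by elim: m => //= m IH; rewrite size_cat IH mulSn.
rewrite !size_cat sf !size_pass /= !(size_cat, size_map, size_nseq).
have -> : size x + (P + T).+2 = W.+2 by rewrite /W /n; lia.
have -> : P + (n + T).+2 = W.+2 by rewrite /W; lia.
by rewrite !mulSn.
Qed.

End Rows.

End Simulation.

(** * The circuit for the utility *)

Section UtilityCircuit.

Variable M : turing_machine.

Let S := simcell M.
Let v0 : S := blank_cell None.

(** Two cells decide acceptance: for the output to be exactly [[:: true]], the second cell must not
    hold a bit. *)
Definition holds_true (v v1 : S) : bool :=
  (sc_right v ord0 == Some (inl true)) &&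
  ~~ (if sc_right v1 ord0 is Some (inl _) then true else false).

Lemma holds_true_ok (c : tm_config M) v v1 : row_ok c 0 v -> row_ok c 1 v1 ->
  holds_true v v1 = (bits_of_tape (c.2 ord0) == [:: true]).
Proof.
rewrite /holds_true => -[_ /(_ ord0) [_ ->]] [_ /(_ ord0) [_ ->]].
rewrite /bits_of_tape; case: (c.2 ord0) => l [|a [|b r]] //=.
  by case: a => [[[]|]|].
case: a => [[[]|a]|] //=; case: b => [[b|b]|] //=.
Qed.

(** Blocks [W.+1] and [W] are the first two cells of the last row; [a] is the number of gates of the
    simulation, so [a] and [a.+1] are the two input wires of the action. *)
Definition utility_vars (W T : nat) : seq nat :=
  let a := T.+2 * (W.+2 * cell_size S) in
  cell_addr S W.+1 ++ cell_addr S W ++ [:: a; a.+1].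

(** In this order: the low and the high bit of the numerator, the denominator 1, and the sign.
    [idle] holds when an action bit is set, that is, for the actions of utility 1. *)
Definition utility_bits : seq (seq bool -> bool) :=
  let idle bs := nth false bs (#|S| + #|S|) || nth false bs (#|S| + #|S|).+1 in
  let acc bs := holds_true (of_one_hot v0 (take #|S| bs))
                  (of_one_hot v0 (take #|S| (drop #|S| bs))) in
  [:: idle; fun bs => ~~ idle bs && acc bs; fun=> true; fun=> false].

Definition utility_stride : nat := dtree_size (#|S| + (#|S| + 2)).

Definition utility_gates (P T : nat) (x : seq bool) : seq gate :=
  sim_gates M P T x ++ block (utility_vars (size x + P + T) T) utility_bits.

Definition utility_circuit (P T : nat) (x : seq bool) : rat_circuit :=
  RatCircuit (utility_gates P T x) (3 * utility_stride)
    [:: 0; utility_stride] [:: 2 * utility_stride].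

Lemma utility_circuit_val P T x a0 a1 inp :
  isSome (tm_run M [:: x; coins M P (a0 :: a1 :: inp)] T) ->
  rat_circuit_val (utility_circuit P T x) (a0 :: a1 :: inp) =
    (if a0 || a1 then 1
     else if tm_run M [:: x; coins M P (a0 :: a1 :: inp)] T == Some [:: true] then 2 else 0)%R.
Proof.
set inp' := a0 :: a1 :: inp; rewrite /tm_run.
have := @sim_row M P T x inp'; set c := iter T _ _.
set W := size x + P + T => hrow.
case: ifP => // _ _.
rewrite (_ : (Some _ == Some _) = (bits_of_tape (c.2 ord0) == [:: true])) //.
rewrite -(holds_true_ok (hrow 0 _) (hrow 1 _)); [|rewrite /W; lia..].
pose w' := wires (utility_gates P T x) inp'; pose u := utility_stride.
transitivity ((-1) ^+ wire w' (3 * u) * ((wire w' 0 + (wire w' u + 0.*2).*2)%N%:R /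
   (wire w' (2 * u) + 0.*2)%N%:R) : rat)%R; first by [].
rewrite /w' /u /utility_gates wires_cat -/W.
set w := wires (sim_gates _ _ _ _) inp'.
set vars := utility_vars W T.
have ub i : i < 4 -> wire (wires (block vars utility_bits) w) (i * utility_stride) =
    nth (fun=> false) utility_bits i [seq wire w a | a <- vars].
  move=> hi; rewrite -(@block_ok vars utility_bits w i hi) /utility_stride.
  by rewrite /vars /utility_vars !size_cat !size_cell_addr.
have := ub 0 isT; have := ub 1 isT; have := ub 2 isT; have := ub 3 isT.
rewrite mul0n mul1n => -> -> -> -> /=.
have sz i : size [seq wire w a | a <- cell_addr S i] = #|S| by rewrite size_map size_cell_addr.
have wi i : wire w (T.+2 * (W.+2 * cell_size S) + i) = wire inp' i.
  by have := wire_shift (sim_gates M P T x) inp' i; rewrite size_sim_gates.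
have eidle : nth false [seq wire w a | a <- vars] (#|S| + #|S|)
    || nth false [seq wire w a | a <- vars] (#|S| + #|S|).+1 = a0 || a1.
  have e i : nth false [seq wire w a | a <- vars] (#|S| + #|S| + i) =
     nth false [:: a0; a1] i.
    rewrite /vars /utility_vars !map_cat catA nth_cat size_cat !sz ltnNge leq_addr addKn.
    move: (wi 0) (wi 1); rewrite addn0 addn1 /= => -> ->.
    by case: i => [|[|i]].
  by move: (e 0) (e 1); rewrite addn0 addn1 => -> ->.
rewrite eidle.
have -> : of_one_hot v0 (take #|S| [seq wire w a | a <- vars]) = row v0 W w 0.
  by rewrite /vars /utility_vars map_cat take_cat sz ltnn subnn take0 cats0.
have -> : of_one_hot v0 (take #|S| (drop #|S| [seq wire w a | a <- vars])) = row v0 W w 1.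
  rewrite /vars /utility_vars !map_cat drop_cat sz ltnn subnn drop0.
  by rewrite take_cat sz ltnn subnn take0 cats0 /row subSS subn0.
by case: (a0 || a1) => //=; case: holds_true.
Qed.

Variables (fP fT : nat -> nat).
Hypotheses (hP : poly_fun fP) (hT : poly_fun fT).

(** All passes are polynomial repetitions of blocks with polynomial addresses; only the input pass
    chooses its block according to the bits of [x]. *)
Lemma generated_utility_gates :
  generated_gates (fun x => utility_gates (fP (size x)) (fT (size x)) x).
Proof.
have c k := poly_fun_const k.
have hW : poly_fun (fun n => n + fP n + fT n).
  exact: poly_fun_add (poly_fun_add poly_fun_id hP) hT.
have hW2 k : poly_fun (fun n => k + (n + fP n + fT n)) by exact: poly_fun_add (c k) hW.
have hb r G : poly_fun r -> generated_gates (fun x => rule_block v0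
    (size x + fP (size x) + fT (size x)) (r (size x)) G).
  by move=> hr; apply: generated_rule_block hW hr.
have hseq k r G : poly_fun k -> poly_fun r -> generated_gates (fun x =>
    pass v0 (size x + fP (size x) + fT (size x)) (nseq (k (size x)) (r (size x), G))).
  move=> hk hr; apply: generated_gates_eq (generated_gates_rep hk (hb r G hr)) => x.
  by rewrite pass_nseq.
apply: generated_gates_cat; last first.
  have ha : poly_fun (fun n => (fT n).+2 * ((n + fP n + fT n).+2 * cell_size S)).
    exact: poly_fun_mul (poly_fun_add (c 2) hT) (poly_fun_mul (hW2 2) (c _)).
  apply: (@generated_block (fun n => utility_vars (n + fP n + fT n) (fT n))).
  exact: (poly_seq_cat (poly_seq_cell_addr _ (hW2 1)) (poly_seq_cat
    (poly_seq_cell_addr _ hW) (poly_seq_cons ha (poly_seq_cons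
    (poly_fun_add (c 1) ha) poly_seq_nil)))).
apply: generated_gates_cat.
  have hi b := hb _ (rule_input (M := M) b) (c 0).
  have h1 := generated_gates_bits (hi false) (hi true).
  have h2 := hseq _ _ (rule_const v0) (poly_fun_add (c 2) (poly_fun_add hP hT)) (c 0).
  apply: generated_gates_eq (generated_gates_cat h1 h2) => x.
  rewrite pass_cat; congr (_ ++ _); rewrite /pass -map_comp; congr flatten.
  by apply: eq_map => -[].
apply: generated_gates_cat.
  have hr : poly_fun (fun n => ((n + fP n + fT n).+2 + fP n) * cell_size S + 2).
    exact: poly_fun_add (poly_fun_mul (poly_fun_add (hW2 2) hP) (c _)) (c 2).
  have hk := poly_fun_add (c 2) (poly_fun_add poly_fun_id hT).
  apply: generated_gates_eq (generated_gates_cat (hseq _ _ (rule_coin (M := M)) hP hr)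
     (hseq _ _ (rule_copy (M := M)) hk (c 0))) => x.
  by rewrite pass_cat.
apply: (generated_gates_rep hT).
apply: generated_gates_eq (generated_gates_cat (hb _ (rule_head (M := M)) (c 0))
  (generated_gates_cat (hb _ (rule_next (M := M)) (c 0))
  (hseq _ _ (rule_far (M := M)) hW (c 0)))) => x.
by [].
Qed.

End UtilityCircuit.

(** * The reduction *)

Import Order.TTheory GRing.Theory Num.Theory.

(** There is only one assignment to no coordinates and it has probability 1, so conditional
    expectations are plain expectations, and a singleton argmax is a strict maximum. *)
Lemma anchor_sufficient_set0 (D : stoch_problem) :
  @stoch_anchor_sufficient D set0 <->
  exists a, forall b, b != a ->
    (\sum_s @sp_P D s * sp_U b s < \sum_s @sp_P D s * sp_U a s)%R.
Proof.
have proj s (alpha : sub_state (set0 : {set 'I_(sp_n D)})) : proj_state set0 s == alpha.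
  by apply/eqP/ffunP => -[i hi]; have := hi; rewrite inE.
have prob alpha : @prob_proj D set0 alpha = 1%R.
  by rewrite -(sp_P_sum1 D); apply: eq_bigl => s; rewrite proj.
have ce a alpha : @cond_expect D set0 a alpha = (\sum_s @sp_P D s * sp_U a s)%R.
  by rewrite /cond_expect prob divr1; apply: eq_bigl => s; rewrite proj.
split=> [[alpha [_ [a ha]]]|[a ha]].
  exists a => b hb; rewrite ltNge; apply/negP => hab; case/negP: hb.
  have /setP /(_ b) := ha; rewrite !inE => <-.
  have /setP /(_ a) := ha; rewrite !inE eqxx => /forallP h.
  apply/forallP => c; move: (h c); rewrite !ce => /le_trans; exact.
(* A state exists since the probabilities sum to 1; it provides the witness [alpha]. *)
have [s _] : exists s : {dffun forall i, @sp_coord D i}, true.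
  case: (pickP (@predT {dffun forall i, @sp_coord D i})) => [s _|h]; first by exists s.
  by have := sp_P_sum1 D; rewrite big_pred0 // => /eqP; rewrite eq_sym oner_eq0.
exists (proj_state set0 s); split; first by rewrite /supp_proj prob ltr01.
exists a; apply/setP => b; rewrite !inE.
apply/forallP/eqP => [h|-> c].
  apply: contraTeq (h a) => /ha; rewrite !ce ltNge //.
by rewrite !ce; have [->//|/ha /ltW] := eqVneq c a.
Qed.

(** * Counting binary states by the coins they contain *)

Section BinaryStates.

Variable m : nat.

Let doms := nseq m 2.

Lemma dom_eq2 (i : 'I_(size doms)) : nth 0 doms i = 2.
Proof. by rewrite nth_nseq; have := ltn_ord i; rewrite {2}size_nseq => ->. Qed.

Definition state_bit (s : dom_state doms) (i : 'I_(size doms)) : bool :=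
  odd (s i : 'I_(nth 0 doms i)).

Lemma bits_of_stateE (s : dom_state doms) :
  bits_of_state s = [seq state_bit s i | i <- enum 'I_(size doms)].
Proof.
rewrite -flatten_map1 /bits_of_state; congr flatten; apply: eq_map => i.
rewrite /state_bit; move: (nat_of_ord (s i : 'I_(nth 0 doms i))) => k; rewrite dom_eq2.
by rewrite /bits_of_nat (_ : up_log 2 2 = 1) //= /mkseq /= divn1.
Qed.

Lemma nth_bits_of_state (s : dom_state doms) (i : 'I_(size doms)) :
  nth false (bits_of_state s) i = state_bit s i.
Proof.
by rewrite bits_of_stateE (nth_map i) ?size_enum_ord ?ltn_ord // nth_ord_enum.
Qed.

Lemma card_dom_state : #|{: dom_state doms}| = 2 ^ m.
Proof.
rewrite card_dep_ffun /image_mem (eq_map (_ : _ =1 fun=> 2)); last first.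
  by move=> i; rewrite /dom_coord /= card_ord dom_eq2.
have : size (enum 'I_(size doms)) = m by rewrite size_enum_ord size_nseq.
by move: (enum _) => e <-; elim: e => //= i e ->; rewrite expnS.
Qed.

Section Fibres.

Variables (P : nat) (idx : 'I_P -> 'I_(size doms)).
Hypothesis idx_inj : injective idx.

Definition sub_bits (s : dom_state doms) : P.-tuple bool :=
  [tuple state_bit s (idx j) | j < P].

Lemma card_odd_ord d b : d = 2 -> #|[pred k : 'I_d | odd k == b]| = 1.
Proof.
move=> ->; rewrite -sum1_card big_mkcond !big_ord_recl big_ord0 /=.
by case: b.
Qed.

(** A fibre is a product: a coin coordinate is forced to one value and a spare one keeps both. The
    size is therefore independent of [rho]. *)
Lemma card_fibre rho :
  #|[set s | sub_bits s == rho]| =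
  foldr muln 1 [seq (if i \in codom idx then 1 else 2) | i : 'I_(size doms)].
Proof.
pose F (i : 'I_(size doms)) : pred (dom_coord i) := fun k =>
  [forall j, (idx j == i) ==> (odd (k : 'I_(nth 0 doms i)) == tnth rho j)].
have -> : #|[set s | sub_bits s == rho]| = #|(family F : simpl_pred (dom_state doms))|.
  apply: eq_card => s; rewrite inE; apply/eqP/familyP => [h i|h].
    by apply/forallP => j; apply/implyP => /eqP <-; rewrite -h tnth_mktuple.
  apply: eq_from_tnth => j; rewrite tnth_mktuple.
  by have /forallP /(_ j) := h (idx j); rewrite eqxx => /eqP.
rewrite card_family; congr (foldr _ _ _); apply: eq_map => i.
case: (boolP (i \in _)) => [/codomP [j ->]|hi].
  rewrite -(card_odd_ord (tnth rho j) (dom_eq2 (idx j))).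
  apply: eq_card => k; rewrite !inE; apply/forallP/idP => [/(_ j)|h j'].
    by rewrite eqxx.
  by apply/implyP => /eqP /idx_inj ->.
transitivity #|'I_(nth 0 doms i)|; last by rewrite card_ord dom_eq2.
apply: eq_card => k; rewrite !inE.
by apply/forallP => j; apply/implyP => /eqP e; case/negP: hi; rewrite -e codom_f.
Qed.

(** All fibres have the same size [c]; the case of the full predicate gives [2 ^ m = 2 ^ P * c],
    which eliminates [c] without evaluating it. *)
Lemma card_sub_bits (A : pred (P.-tuple bool)) :
  #|[set s | A (sub_bits s)]| * 2 ^ P = #|[set r | A r]| * 2 ^ m.
Proof.
set c := foldr muln 1 [seq (if i \in codom idx then 1 else 2) | i : 'I_(size doms)].
have h (A' : pred (P.-tuple bool)) : #|[set s | A' (sub_bits s)]| = #|[set r | A' r]| * c.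
  rewrite -sum1_card (partition_big sub_bits A') => [|s]; last by rewrite inE.
  rewrite -sum_nat_const; apply: eq_big => [r|r hr]; first by rewrite inE.
  rewrite /c -(card_fibre r) -sum1_card; apply: eq_bigl => s; rewrite !inE andbC.
  by case: eqP => // ->.
have := h predT; rewrite (eq_card (_ : _ =i predT)) => [|s]; last by rewrite !inE.
rewrite card_dom_state [X in X * c](eq_card (_ : _ =i predT)) => [|s]; last by rewrite !inE.
by rewrite card_tuple card_bool h => ->; rewrite mulnAC mulnA.
Qed.

End Fibres.

End BinaryStates.

(** After the two gates, wire 0 is true and wire 1 false: positive sign, numerator 1, and
    denominator [2 ^ m] written as [m] zeros followed by a one. *)
Definition uniform_circuit (m : nat) : rat_circuit :=
  RatCircuit [:: GConst false; GConst true] 1 [:: 0] (rcons (nseq m 1) 0).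

Lemma uniform_circuit_val m inp :
  rat_circuit_val (uniform_circuit m) inp = ((2 ^ m)%N%:R^-1)%R.
Proof.
rewrite /rat_circuit_val /= expr0 mul1r mul1r; congr (_%:R^-1)%R.
elim: m => //= m ->; rewrite add0n expnS mul2n //.
Qed.

Section Reduction.

Variables (M : turing_machine) (fP fT : nat -> nat).

(** The farthest coin sits at position [P * cell_size], so [P.+1] block lengths suffice; all the
    positions between coins are spare. *)
Definition coin_bits (x : seq bool) : nat := (fP (size x)).+1 * cell_size (simcell M).

Lemma uniform_ge0 m doms (s : dom_state doms) : (0 <= circuit_P (uniform_circuit m) s)%R.
Proof. by rewrite /circuit_P uniform_circuit_val invr_ge0 ler0n. Qed.

Lemma uniform_sum1 m :
  (\sum_(s : dom_state (nseq m 2)) circuit_P (uniform_circuit m) s = 1)%R.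
Proof.
under eq_bigr do rewrite /circuit_P uniform_circuit_val.
rewrite sumr_const card_dom_state -[LHS]mulr_natl divff // pnatr_eq0.
by rewrite expn_eq0.
Qed.

Definition reduction (x : seq bool) : succinct_instance :=
  @SuccinctInstance 3 (nseq (coin_bits x) 2)
    (utility_circuit M (fP (size x)) (fT (size x)) x)
    (uniform_circuit (coin_bits x)) (@uniform_ge0 _ _) (uniform_sum1 _) set0.

Hypotheses (hP : poly_fun fP) (hT : poly_fun fT).

Lemma enc_seq_flatten (T : Type) (e : T -> seq bool) s :
  enc_seq e s = flatten [seq true :: e y | y <- s] ++ [:: false].
Proof. by elim: s => //= y s ->; rewrite catA. Qed.

Lemma generated_reduction : generated (fun x => enc_instance (reduction x)).
Proof.
have c s := generated_const s.
have hm : poly_fun (fun n => (fP n).+1 * cell_size (simcell M)).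
  exact: poly_fun_mul (poly_fun_add (poly_fun_const 1) hP) (poly_fun_const _).
have hU := generated_utility_gates M hP hT.
have h1 := generated_cat (c (enc_nat 3))
  (generated_cat (generated_rep hm (c (true :: enc_nat 2))) (c [:: false])).
have h2 := generated_cat hU (c ([:: false] ++ enc_nat (3 * utility_stride M)
   ++ enc_seq enc_nat [:: 0; utility_stride M] ++ enc_seq enc_nat [:: 2 * utility_stride M])).
have h3 := generated_cat (c (enc_seq enc_gate [:: GConst false; GConst true] ++ enc_nat 1
    ++ enc_seq enc_nat [:: 0])) (generated_cat (generated_rep hm (c (true :: enc_nat 1)))
      (c (true :: enc_nat 0 ++ [:: false]))).
have h4 := generated_cat (generated_rep hm (c [:: true; false])) (c [:: false]).
apply: generated_eq (generated_cat h1 (generated_cat h2 (generated_cat h3 h4))) => x.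
rewrite /enc_instance /enc_rat_circuit !(enc_seq_flatten enc_nat) !(enc_seq_flatten enc_gate).
rewrite (enc_seq_flatten enc_bool).
rewrite /reduction /utility_circuit /uniform_circuit.
cbn [si_actions si_doms si_U si_P si_I rc_gates rc_sign rc_num rc_den].
rewrite map_nseq map_rcons map_nseq flatten_rcons -!catA.
have -> k : [seq true :: enc_bool y | y <- [seq i \in set0 | i <- enum 'I_k]] =
    nseq k [:: true; false].
  rewrite -[in RHS](size_enum_ord k); elim: (enum _) => //= i e <-.
  by rewrite inE.
by rewrite size_nseq.
Qed.

Section Correct.

Variable x : seq bool.

Let P := fP (size x).
Let T := fT (size x).
Let m := coin_bits x.
Let cs := cell_size (simcell M).

Lemma cell_size_gt0 : 0 < cs.
Proof.
rewrite muln_gt0; apply/andP; split; first by apply/card_gt0P; exists (blank_cell None).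
by rewrite /stride addnA addnA addnA addn1 /= addn_gt0 orbT.
Qed.

Lemma coin_index_proof (j : 'I_P) : (P - j) * cs < size (nseq m 2).
Proof.
rewrite size_nseq /m /coin_bits -/P -/cs ltn_mul2r cell_size_gt0 /=.
by rewrite ltnS leq_subr.
Qed.

Definition coin_index (j : 'I_P) : 'I_(size (nseq m 2)) := Ordinal (coin_index_proof j).

Lemma coin_index_inj : injective coin_index.
Proof.
move=> i j /(congr1 val) /= /eqP; rewrite eqn_mul2r gtn_eqF ?cell_size_gt0 //= => /eqP h.
by apply: val_inj => /=; have := ltn_ord i; have := ltn_ord j; lia.
Qed.

Lemma coins_state a0 a1 (s : dom_state (nseq m 2)) :
  coins M P (a0 :: a1 :: bits_of_state s) = sub_bits coin_index s.
Proof.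
apply: (@eq_from_nth _ false) => [|j]; rewrite size_mkseq ?size_tuple // => hj.
rewrite nth_mkseq // /wire addn2 /=.
have := tnth_nth false (sub_bits coin_index s) (Ordinal hj); rewrite tnth_mktuple => /= <-.
exact: (nth_bits_of_state s (coin_index (Ordinal hj))).
Qed.

Hypothesis M_halts : forall r : P.-tuple bool, isSome (tm_run M [:: x; val r] T).

Let acc (r : P.-tuple bool) : bool := tm_run M [:: x; val r] T == Some [:: true].

Lemma reduction_utility (b : 'I_3) (s : dom_state (nseq m 2)) :
  circuit_U (si_U (reduction x)) b s =
    (if b == ord0 then if acc (sub_bits coin_index s) then 2 else 0 else 1)%R.
Proof.
(* Three actions take two bits, and action 0 is the only one with both bits false. *)
rewrite /circuit_U (_ : bits_of_nat 3 b = [:: odd b; odd (b %/ 2)]).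
  rewrite utility_circuit_val coins_state; last exact: M_halts.
  by case: b => -[|[|[|b]]].
by rewrite /bits_of_nat (_ : up_log 2 3 = 2) // /mkseq /= divn1.
Qed.

Lemma expected_utility (b : 'I_3) :
  (\sum_(s : dom_state (nseq m 2)) circuit_P (si_P (reduction x)) s *
      circuit_U (si_U (reduction x)) b s =
   if b == ord0 then (2 * #|[set r | acc r]|)%N%:R / (2 ^ P)%N%:R else 1)%R.
Proof.
case: eqP => [->|/eqP hb]; last first.
  rewrite -[RHS](uniform_sum1 m); apply: eq_bigr => s _.
  by rewrite reduction_utility (negbTE hb) mulr1.
under eq_bigr do rewrite reduction_utility eqxx /circuit_P uniform_circuit_val.
rewrite -mulr_sumr -big_mkcond /= sumr_const.
have pos k : ((2 ^ k)%N%:R != 0 :> rat)%R by rewrite pnatr_eq0 expn_eq0.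
(* Clearing the denominators [2 ^ m] and [2 ^ P] leaves the counting identity [card_sub_bits]. *)
apply: (canLR (mulKf (pos m))); rewrite mulrA; apply: (canRL (mulfK (pos P))).
rewrite -[(2 *+ _)%R]mulr_natr -!natrM; congr (_%:R)%R.
have := card_sub_bits coin_index_inj acc; rewrite cardsE => h.
by rewrite -mulnA h mulnCA mulnC -mulnA mulnCA.
Qed.

Lemma reduction_correct :
  dp_yes (d := stochastic_anchor_sufficiency_check) (reduction x) <->
  2 ^ P < 2 * #|[set r | acc r]|.
Proof.
pose E (b : 'I_3) : rat :=
  (if b == ord0 then (2 * #|[set r | acc r]|)%N%:R / (2 ^ P)%N%:R else 1)%R.
have h : dp_yes (d := stochastic_anchor_sufficiency_check) (reduction x) <->
    exists a : 'I_3, forall b : 'I_3, b != a -> (E b < E a)%R.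
  have [h1 h2] := anchor_sufficient_set0 (problem_of_instance (reduction x)).
  split=> [/h1 [a ha]|[a ha]].
    by exists a => b /ha; rewrite /= !expected_utility.
  by apply: h2; exists a => b /ha; rewrite /= !expected_utility.
have e0 : (1 < E ord0)%R = (2 ^ P < 2 * #|[set r | acc r]|).
  by rewrite /E eqxx ltr_pdivlMr ?ltr0n ?expn_gt0 // mul1r ltr_nat.
rewrite h -e0; split=> [[a ha]|h0]; last first.
  by exists ord0 => b hb; rewrite {1}/E (negbTE hb).
(* Of the two actions with utility 1, neither can be the strict optimum, since the other ties with
   it. *)
pose b1 : 'I_3 := inord 1; pose b2 : 'I_3 := inord 2.
have hb1 : b1 != ord0 by rewrite -val_eqE /= inordK.
have hb2 : b2 != ord0 by rewrite -val_eqE /= inordK.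
have hb12 : b1 != b2 by rewrite -val_eqE /= !inordK.
have [ea|na] := eqVneq a ord0.
  by have := ha b1; rewrite ea hb1 {1}/E (negbTE hb1); apply.
have [b [hb nb]] : exists b : 'I_3, b != a /\ b != ord0.
  have [e|?] := eqVneq b1 a; last by exists b1.
  by exists b2; rewrite eq_sym -e.
by have := ha b hb; rewrite /E (negbTE na) (negbTE nb) ltxx.
Qed.

End Correct.

End Reduction.

Theorem mainTheorem10 : PP_hard stochastic_anchor_sufficiency_check.
Proof.
move=> L [M [p [q [halts hL]]]].
have [fP hP eP] := poly_fun_horner p; have [fT hT eT] := poly_fun_horner q.
exists (reduction M fP fT); split.
  exact: generated_poly_time (generated_reduction M hP hT).
move=> x; rewrite hL -eP -eT; symmetry; apply: reduction_correct => r.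
by move: r; rewrite eP eT; apply: halts.
Qed.
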